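(* Let $\mathcal{P}$ be an arbitrary finite polysquare surface. A half-infinite $1$-direction geodesic $\mathcal{L}(t)$, $t\ge 0$, on $\mathcal{P}$ is superdense on $\mathcal{P}$ if and only if the slope of the geodesic is a badly approximable number.
   Context: A finite polysquare region $P$ is a connected (not necessarily simply-connected) polygon in the plane tiled by finitely many closed unit squares (the atomic squares) such that (i) any two atomic squares either are disjoint, or intersect at a single point, or have a common edge; (ii) any two atomic squares are joined by a chain of atomic squares in which any two neighbours have a common edge. $P$ may have holes, and may have whole barriers, i.e. horizontal or vertical walls consisting of one or more boundary edges of atomic squares. A finite polysquare surface $\mathcal{P}$ is obtained from such a region by identifying the horizontal boundary edges in pairs and the vertical boundary edges in pairs (by translation), so that a $1$-direction geodesic flow (straight-line flow of constant slope) is defined on $\mathcal{P}$. A half-infinite geodesic is a $1$-direction geodesic $\mathcal{L}(t)$ with arc-length parametrization defined for all $t\ge0$ (it does not hit a vertex singularity). Such a geodesic is superdense on $\mathcal{P}$ if there exists an absolute constant $C_1=C_1(\mathcal{P};\mathcal{L})>0$ such that, for every integer $n\ge1$, the initial segment $\mathcal{L}(t)$, $0\le t\le C_1 n$, gets $1/n$-close to every point of $\mathcal{P}$. A real number is badly approximable if it is irrational and its continued fraction digits are bounded. *)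

(* Defs.v *)
From mathcomp Require Import all_boot all_order all_algebra all_fingroup finmap.
From mathcomp Require Import all_classical all_reals all_analysis.
From Stdlib Require Import Relations.Relation_Operators.

Set Implicit Arguments.
Unset Strict Implicit.
Unset Printing Implicit Defensive.

Import Order.TTheory GRing.Theory Num.Theory.

Local Open Scope fset_scope.
Local Open Scope classical_set_scope.
Local Open Scope ring_scope.

Definition right_of (c : int * int) : int * int := (c.1 + 1, c.2).
Definition above (c : int * int) : int * int := (c.1, c.2 + 1).

Definition share_edge (c d : int * int) : bool :=
  [|| d == right_of c, c == right_of d, d == above c | c == above d].

(* The atomic square with lower left corner (i, j) is encoded by (i, j), so any
   two distinct atomic squares are disjoint, meet in a single point or have a
   common edge.  Squares on the two sides of a barrier still have a common edge
   in the plane: barriers only affect which edges are boundary edges. *)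
Record polysquare_region := PolysquareRegion {
  squares : {fset int * int};
  (* [c \in vbarriers]: the right edge of [c] belongs to a vertical barrier *)
  vbarriers : {set squares};
  (* [c \in hbarriers]: the top edge of [c] belongs to a horizontal barrier *)
  hbarriers : {set squares};
  squares_neq0 : squares != fset0;
  squares_chain : forall c d : squares,
    connect (fun a b : squares => share_edge (val a) (val b)) c d
}.

(* [east c] is the square whose left edge is identified with the right edge of
   [c], and [north c] the square whose bottom edge is identified with the top
   edge of [c].  Away from boundary edges they are the neighbours in the plane;
   hence, being bijective, they pair the right boundary edges with the left
   boundary edges, and the top ones with the bottom ones, arbitrarily.
   As a barrier may cut the region into pieces, connectedness of the surface
   does not follow from [squares_chain]. *)
Record polysquare_surface := PolysquareSurface {
  region :> polysquare_region;
  east : {perm squares region};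
  north : {perm squares region};
  east_inner : forall c d : squares region,
    val d = right_of (val c) -> c \notin vbarriers region -> east c = d;
  north_inner : forall c d : squares region,
    val d = above (val c) -> c \notin hbarriers region -> north c = d;
  surface_connected : forall c d : squares region,
    connect (fun a b => (east a == b) || (north a == b)) c d
}.

Section Surface.
Variables (R : realType) (S : polysquare_surface).

Definition in_unit_square (x y : R) : Prop := 0 <= x <= 1 /\ 0 <= y <= 1.

(* Points of the surface are handled through representatives: [(c, x, y)] is
   the planar point (i + x, j + y) of the closed atomic square c = (i, j). *)
Definition surface_point : Type := (squares S * R * R)%type.

Definition on_surface (p : surface_point) : Prop := in_unit_square p.1.2 p.2.

Variant glued : surface_point -> surface_point -> Prop :=
| GluedV (c : squares S) (y : R) of 0 <= y <= 1 : glued (c, 1, y) (east S c, 0, y)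
| GluedH (c : squares S) (x : R) of 0 <= x <= 1 : glued (c, x, 1) (north S c, x, 0).

Definition same_point : surface_point -> surface_point -> Prop :=
  clos_refl_sym_trans surface_point glued.

Definition corner (k : squares S * bool * bool) : surface_point :=
  (k.1.1, k.1.2%:R, k.2%:R).

(* Each corner of an atomic square contributes an angle pi / 2. *)
Definition cone_angle (p : surface_point) : R :=
  #|[pred k : squares S * bool * bool | `[< same_point (corner k) p >]]|%:R
  * (pi / 2).

Definition vertex_singularity (p : surface_point) : Prop :=
  (exists k, same_point (corner k) p) /\ cone_angle p != 2 * pi.

(* [joined p q l]: some broken line of length [l] on the surface, each edge of
   which lies in one closed atomic square, goes from [p] to [q]. *)
Inductive joined : surface_point -> surface_point -> R -> Prop :=
| JoinedSame p q of same_point p q : joined p q 0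
| JoinedSegment c x y x' y' of in_unit_square x y & in_unit_square x' y' :
    joined (c, x, y) (c, x', y') (Num.sqrt ((x' - x) ^+ 2 + (y' - y) ^+ 2))
| JoinedTrans p q r l m of joined p q l & joined q r m : joined p r (l + m).

Definition flat_dist (p q : surface_point) : R := inf [set l | joined p q l].

Definition straight_on (L : R -> surface_point) (u v a b : R) : Prop :=
  exists c x y, forall t, a <= t <= b ->
    in_unit_square (x + (t - a) * u) (y + (t - a) * v) /\
    same_point (L t) (c, x + (t - a) * u, y + (t - a) * v).

(* As the vertex singularities are avoided, exactly one straight germ with
   direction (u, v) leaves each [L t], possibly across an edge or a vertex of
   cone angle 2 pi.  The values of [L] on negative reals are irrelevant. *)
Definition half_infinite_geodesic (L : R -> surface_point) (u v : R) : Prop :=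
  [/\ u ^+ 2 + v ^+ 2 = 1,
      forall t, 0 <= t -> on_surface (L t) /\ ~ vertex_singularity (L t),
      forall t, 0 <= t -> exists2 d, 0 < d & straight_on L u v t (t + d) &
      forall t, 0 < t -> exists2 d, 0 < d <= t & straight_on L u v (t - d) t].

Definition superdense (L : R -> surface_point) : Prop :=
  exists2 C1 : R, 0 < C1 &
    forall n : nat, (1 <= n)%N -> forall p : surface_point, on_surface p ->
      exists2 t : R, 0 <= t <= C1 * n%:R & flat_dist (L t) p <= n%:R^-1.

End Surface.

Section BadlyApproximable.
Variable R : realType.

(* The iteration only breaks down (division by 0) when [a] is rational. *)
Definition cf_tail (a : R) (k : nat) : R :=
  iter k (fun x => (x - (Num.floor x)%:~R)^-1) a.

Definition cf_digit (a : R) (k : nat) : int := Num.floor (cf_tail a k).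

Definition badly_approximable (a : R) : Prop :=
  irrational a /\ exists M : int, forall k, `|cf_digit a k| <= M.

End BadlyApproximable.

(* Main.v *)
Require Import Defs.
From mathcomp Require Import all_boot all_order all_algebra all_fingroup finmap.
From mathcomp Require Import all_classical all_reals all_analysis.
From mathcomp Require Import ring lra.
From Stdlib Require Import Relations.Relation_Operators.

(** Write U = |u| and V = |v|, and reflect the coordinates so that the flow goes
    up and to the right.  A square entered through its left or bottom side is
    then entered at a point determined by s = V x - U y, which lies in [-U, V[,
    and the flow induces on squares times [-U, V[ the skew product T over the
    exchange of two intervals

      (c, s) |-> (north c, s + U) if s < V - U,  (east c, s - V) otherwise.

    _From badly approximable to superdense._  Subtracting the smaller of the two
    widths from the larger one, again and again, is Rauzy induction: at level k
    the first-return map to an interval of two widths is again an exchange of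
    two intervals, whose branches follow two fixed words in the original letters
    and permute the squares by two permutations which still generate a
    transitive group.  If the slope is badly approximable, the two widths stay
    comparable ([badly_approximable_euclid]), so that the words of level k are
    as long as the interval of level k is short.

    The heart of the proof is that, boundedly many levels later, every long word
    started from any square visits all pairs (square, short letter).  A step
    replaces one word by the concatenation of the two words, so the sets of pairs
    visited can only grow.  If they do not grow during steps of kinds m, then
    ~~ m (repeated), then m, comparing the inclusions obtained forces these sets
    to be invariant under a transitive pair of permutations, hence to be full
    ([stable_visits]).  A counting argument ends the proof ([full_visits]).

    Now every point of squares times [-U, V[ sits in the tower over some pair
    (square, letter) at the level of size about 1/n, and the branches are
    translations, so visiting that pair is enough to pass 1/n-close to the
    point: T is dense at scale 1/n after O(n) steps ([orbit_dense]).  The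
    geodesic follows T ([enters_next]) once it is past the at most one corner
    that an irrational line can meet ([eventually_regular]).

    _From superdense to badly approximable._  For integers a and b the function
    a x + b y mod 1 is well defined on the surface and drifts at the speed
    a u + b v along the geodesic.  If it is to come close to every value in a
    time of order |a| + |b|, that speed is at least of order 1 / (|a| + |b|)
    ([superdense_gap]); applied to convergents, this bounds the digits
    ([badly_approximable_of_gap]). *)

Set Implicit Arguments.
Unset Strict Implicit.
Unset Printing Implicit Defensive.

Import Order.TTheory GRing.Theory Num.Theory.

Local Open Scope ring_scope.

(** * Visits of blocks: a finite growth argument *)

Section Blocks.
Variable Q : finType.
Implicit Types (m x : bool) (c d : Q).

Definition upd (A : Type) (m : bool) (a : A) (g : bool -> A) : bool -> A :=
  fun x => if x == m then a else g x.

(** Letters are booleans.  A move of kind m replaces the word of letter m by the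
    word of ~~ m followed by the word of m. *)
Definition perm_move m (p : bool -> {perm Q}) : bool -> {perm Q} :=
  upd m (p (~~ m) * p m)%g p.

(** [f x c] is meant to collect the pairs (square, letter) met along the word of
    letter x when this word ends at the square c.  Indexing by the end of the
    word is what makes moves monotone: the old word of m is a suffix of the new
    one. *)
Definition visits : Type := bool -> Q -> {set Q * bool}.

Definition visit_move m (p : bool -> {perm Q}) (f : visits) : visits :=
  upd m (fun c => f m c :|: f (~~ m) ((p m)^-1%g c)) f.

Definition visit0 (p : bool -> {perm Q}) : visits :=
  fun x c => [set ((p x)^-1%g c, x)].

(** Transitivity of the generated group, phrased through invariant functions so
    that it passes to the new generators directly. *)
Definition transitive_pair (p : bool -> {perm Q}) : Prop :=
  forall (T : Type) (g : Q -> T), (forall x c, g (p x c) = g c) ->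
  forall c d, g c = g d.

Lemma transitive_move m p : transitive_pair p -> transitive_pair (perm_move m p).
Proof.
move=> tr T g gp; apply: tr.
have gN c : g (p (~~ m) c) = g c.
  by have := gp (~~ m) c; rewrite /perm_move /upd; case: (m).
move=> x c; have [->|] := eqVneq x m; last first.
  by case: x; case: m gN {gp} => // gN _.
have := gp m ((p (~~ m))^-1%g c).
by rewrite /perm_move /upd eqxx permM permKV => ->; rewrite -gN permKV.
Qed.

(** Summing cardinals over all squares turns the inclusions into equalities. *)
Lemma subset_cycle (T : finType) (f : Q -> {set T}) (s : {perm Q}) :
  (forall c, f c \subset f (s c)) -> forall c, f (s c) = f c.
Proof.
move=> sub c.
have /leqif_sum : forall i : Q, true -> (#|f i| <= #|f (s i)| ?= iff (f i == f (s i)))%N.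
  by move=> i _; apply: subset_leqif_cards.
move=> [_]; rewrite [X in X == _](reindex_inj (@perm_inj _ s)) /= eqxx.
by move=> /esym/forallP/(_ c)/eqP.
Qed.

(** The three inclusions say that the visits do not grow in a move of kind m, in
    a later move of kind ~~ m and in a still later one of kind m; meanwhile the
    permutation of m has become [a \o b].  The first two make [f m] invariant
    under [a \o b] (by [subset_cycle]), and then the third one makes it
    invariant under a. *)
Lemma stable_visits m (f : visits) (a b : {perm Q}) :
  (forall c, f (~~ m) c \subset f m (a c)) ->
  (forall c, f m c \subset f (~~ m) (b c)) ->
  (forall c, f (~~ m) c \subset f m (a (b c))) ->
  forall c, [/\ f m (a c) = f m c, f m (b c) = f m c & f (~~ m) c = f m c].
Proof.
move=> h1 h2 h3.
have ab c : f m (a (b c)) = f m c.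
  have sub d : f m d \subset f m ((b * a)%g d).
    by rewrite permM; apply: fintype.subset_trans (h2 d) _; apply: h1.
  by rewrite -permM (subset_cycle sub).
have f_b c : f (~~ m) (b c) = f m c.
  by apply/eqP; rewrite finset.eqEsubset h2 -[f m c]ab h1.
have fE c : f (~~ m) c = f m (a c) by rewrite -{1}(permKV b c) f_b -ab permKV.
have aE c : f m (a c) = f m c.
  have sub d : f m d \subset f m (a^-1%g d).
    by rewrite -{1}(permKV a d) -fE -(ab (a^-1%g d)); apply: h3.
  by rewrite -(subset_cycle sub) permK.
by move=> c; split=> //; rewrite ?fE // -aE ab.
Qed.

Section Run.
Variables (mv : nat -> bool) (p : nat -> bool -> {perm Q}) (f : nat -> visits).
Hypothesis pS : forall i, p i.+1 = perm_move (mv i) (p i).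
Hypothesis fS : forall i, f i.+1 = visit_move (mv i) (p i) (f i).
Hypothesis f0 : f 0 = visit0 (p 0).
Hypothesis p0 : transitive_pair (p 0).
Variable W : nat.
Hypothesis mvW : forall i, exists2 j, (j < W)%N & mv (i + j) != mv i.

Definition weight (g : visits) := (\sum_(z : bool * Q) #|g z.1 z.2|)%N.

Lemma transitive_run i : transitive_pair (p i).
Proof. by elim: i => // i IH; rewrite pS; apply: transitive_move. Qed.

Lemma visits_incr i x c : f i x c \subset f i.+1 x c.
Proof. by rewrite fS /visit_move /upd; case: eqP => // ->; apply: finset.subsetUl. Qed.

Lemma visits_mono i j x c : (i <= j)%N -> f i x c \subset f j x c.
Proof.
move=> /subnK <-; elim: (j - i)%N => // k IH.
by apply: fintype.subset_trans IH _; rewrite addSn; apply: visits_incr.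
Qed.

(** Among 2 W + 1 moves there are, in this order, a move of kind m, some moves of
    kind ~~ m and a move of kind m, as required by [stable_visits]. *)
Lemma full_or_grow i :
  (forall x c, f i x c = [set: Q * bool]) \/
  (weight (f i) < weight (f (i + (2 * W).+1)))%N.
Proof.
set j := (i + _)%N.
have leif (z : bool * Q) : true ->
    (#|f i z.1 z.2| <= #|f j z.1 z.2| ?= iff (f i z.1 z.2 == f j z.1 z.2))%N.
  by move=> _; apply/subset_leqif_cards/visits_mono/leq_addr.
have [le eqw] := leqif_sum leif.
have [|ne] := boolP [forall (z | true), f i z.1 z.2 == f j z.1 z.2]; last first.
  by right; rewrite /weight ltn_neqAle eqw ne.
move=> /forallP st; left.
have fE k x c : (i <= k <= j)%N -> f k x c = f i x c.
  move=> /andP[ik kj]; apply/eqP; rewrite finset.eqEsubset (visits_mono x c ik) andbT.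
  by have /= /eqP -> := st (x, c); apply: visits_mono.
have move_sub k : (i <= k < j)%N -> forall c,
    f i (~~ mv k) c \subset f i (mv k) (p k (mv k) c).
  move=> /andP[ik kj] c.
  rewrite -(fE k.+1 (mv k)) ?(leqW ik)// fS /visit_move /upd eqxx permK.
  by rewrite (fE k (~~ mv k)) ?ik ?(ltnW kj)// finset.subsetUr.
have ex1 : exists k, mv (i + k) != mv i by have [k _] := mvW i; exists k.
have := ex_minnP ex1 => -[k1 k1P k1min].
have k1W : (k1 < W)%N by have [k kW /k1min] := mvW i; move=> /leq_ltn_trans; apply.
case: k1 => [|k1] in k1P k1min k1W *; first by rewrite addn0 eqxx in k1P.
pose m := mv i.
have mk1 : mv (i + k1) = m.
  by apply/eqP; apply/negPn/negP => /k1min; rewrite ltnn.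
have mk1S : mv (i + k1.+1) = ~~ m by move: k1P; rewrite /m; case: mv; case: mv.
have ex2 : exists k, mv (i + k1.+1 + k) != mv (i + k1.+1).
  by have [k _] := mvW (i + k1.+1); exists k.
have := ex_minnP ex2 => -[k2 k2P k2min].
have k2W : (k2 < W)%N.
  by have [k kW /k2min] := mvW (i + k1.+1); move=> /leq_ltn_trans; apply.
have mk2 : mv (i + k1.+1 + k2) = m by move: k2P; rewrite mk1S; case: mv; case: (m).
have pk k : (k <= k2)%N -> p (i + k1.+1 + k) m = p (i + k1.+1) m.
  elim: k => [|k IH] kk2; first by rewrite addn0.
  rewrite -IH ?(ltnW kk2)// addnS pS /perm_move /upd.
  have -> : mv (i + k1.+1 + k) = ~~ m.
    rewrite -mk1S; apply/eqP; apply/negPn/negP => /k2min.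
    by rewrite leqNgt kk2.
  by case: (m).
have pj : p (i + k1.+1) m = (p (i + k1) (~~ m) * p (i + k1) m)%g.
  by rewrite addnS pS /perm_move /upd mk1 eqxx.
have pjN : p (i + k1.+1) (~~ m) = p (i + k1) (~~ m).
  by rewrite addnS pS /perm_move /upd mk1; case: (m).
have WW : (k1.+1 + k2 < (2 * W).+1)%N.
  by rewrite ltnS mul2n -addnn leq_add // ltnW.
have key := @stable_visits m (f i) (p (i + k1) m) (p (i + k1) (~~ m)) _ _ _.
have {}key : forall c, [/\ f i m (p (i + k1) m c) = f i m c,
    f i m (p (i + k1) (~~ m) c) = f i m c & f i (~~ m) c = f i m c].
  apply: key => c.
  - have := move_sub (i + k1)%N; rewrite mk1; apply; rewrite leq_addr /= ltn_add2l.
    by apply: leq_ltn_trans WW; apply: leq_trans (leqnSn _) (leq_addr _ _).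
  - have := move_sub (i + k1.+1)%N; rewrite mk1S negbK pjN; apply.
    by rewrite leq_addr /= ltn_add2l; apply: leq_ltn_trans WW; apply: leq_addr.
  - have := move_sub (i + k1.+1 + k2)%N; rewrite -permM -pj -(pk k2) // mk2; apply.
    by rewrite -addnA leq_addr /= ltn_add2l.
have inv : forall x c, f i m (p (i + k1) x c) = f i m c.
  move=> x c; have [? ? _] := key c.
  by have /orP[/eqP->|/eqP->] : (x == m) || (x == ~~ m) by case: x; case: (m).
have cst c d : f i m c = f i m d by apply: (transitive_run inv).
have all_m x c : f i x c = f i m c.
  have [_ _ ?] := key c.
  by have /orP[/eqP->|/eqP->] : (x == m) || (x == ~~ m) by case: x; case: (m).
have z0 y d : (d, y) \in f i y (p 0 y d).
  apply: (fintype.subsetP (visits_mono y (p 0 y d) (leq0n i))).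
  by rewrite f0 /visit0 inE permK.
move=> x c; apply/finset.setP => -[d y]; rewrite inE.
by rewrite all_m (cst c (p 0 y d)) -(all_m y) z0.
Qed.

Definition full_time := ((2 * W).+1 * (#|{: bool * Q}| * #|{: Q * bool}|).+1)%N.

Lemma full_visits x c : f full_time x c = [set: Q * bool].
Proof.
have grow n : (forall x c, f ((2 * W).+1 * n) x c = [set: Q * bool]) \/
    (n <= weight (f ((2 * W).+1 * n)))%N.
  elim: n => [|n [full|le]]; first by right.
    left=> y d; apply/eqP; rewrite -finset.subTset -(full y d); apply: visits_mono.
    by rewrite leq_mul2l leqnSn orbT.
  have [full|lt] := full_or_grow ((2 * W).+1 * n); last first.
    by right; rewrite mulnS addnC; apply: leq_ltn_trans lt.
  left=> y d; apply/eqP; rewrite -finset.subTset -(full y d); apply: visits_mono.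
  by rewrite leq_mul2l leqnSn orbT.
have wle g : (weight g <= #|{: bool * Q}| * #|{: Q * bool}|)%N.
  rewrite -sum_nat_const; apply: leq_sum => z _; exact: max_card.
have [|/leq_trans/(_ (wle _))] := grow (#|{: bool * Q}| * #|{: Q * bool}|).+1.
  by apply.
by rewrite ltnn.
Qed.
End Run.
End Blocks.

(** * Renormalization of the first-return map *)

Section Induction.
Variables (R : realType) (Q : finType).

(** One stage of the induction.  The base [-width false, width true[ is exchanged
    by two translations: the letter true moves its right part by -width true, the
    letter false its left part by width false.  The return to the base along the
    word of a letter has [len] steps and permutes the squares by [monodromy]. *)
Record level := Level {
  width : bool -> R; monodromy : bool -> {perm Q}; len : bool -> nat }.

Implicit Types (l : level) (c d : Q) (s r : R) (x y : bool).

Definition euclid_letter (w : bool -> R) : bool := w false < w true.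
Definition euclid_step (w : bool -> R) : bool -> R :=
  let m := euclid_letter w in upd m (w m - w (~~ m)) w.

Definition step l : level :=
  let m := euclid_letter (width l) in
  Level (euclid_step (width l)) (perm_move m (monodromy l))
        (upd m (len l m + len l (~~ m))%N (len l)).

Arguments step : simpl never.

Definition base l s := - width l false <= s < width l true.
Definition letter l s : bool := width l true - width l false <= s.
Definition shift l x : R := if x then - width l true else width l false.
Definition induced l (z : Q * R) : Q * R :=
  (monodromy l (letter l z.2) z.1, z.2 + shift l (letter l z.2)).

Lemma inducedE l c s :
  induced l (c, s) = (monodromy l (letter l s) c, s + shift l (letter l s)).
Proof. by []. Qed.

Definition positive l := forall x, 0 < width l x.

Section Step.
Variable l : level.
Hypotheses (lP : positive l) (slP : positive (step l)).
Let m := euclid_letter (width l).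

Ltac levels :=
  move: (lP true) (lP false) (slP true) (slP false);
  rewrite /base /letter /shift /m /step /euclid_step /euclid_letter /upd /=;
  case: (ltP (width l false) (width l true)) => /=.

(** The shorter base is exactly the old domain of the letter ~~ m; the new
    letter m is the part of it that ~~ m sends into the old domain of m
    ([base_step_mid]).  This is why the new word of m is the word of ~~ m
    followed by that of m. *)
Lemma base_step s : base (step l) s -> base l s /\ letter l s = ~~ m.
Proof.
levels => ? ? ? ? ? ?; (split; first lra); last lra.
by apply/negbTE; rewrite -ltNge; lra.
Qed.

Lemma step_base s : base l s -> letter l s = ~~ m -> base (step l) s.
Proof.
levels => ? ? ? ? ?.
  by move=> ? /negbT; rewrite -ltNge => ?; lra.
by move=> ? ?; lra.
Qed.

Lemma base_step_mid s : base (step l) s -> letter (step l) s = m ->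
  base l (s + shift l (~~ m)) /\ letter l (s + shift l (~~ m)) = m.
Proof.
levels => ? ? ? ? ? ?.
  by move=> ?; split; lra.
move=> /negbT; rewrite -ltNge => ?; split; first lra.
by apply/negbTE; rewrite -ltNge; lra.
Qed.

Lemma mid_base_step s : base l s -> letter l s = m ->
  base (step l) (s - shift l (~~ m)) /\ letter (step l) (s - shift l (~~ m)) = m.
Proof.
levels => ? ? ? ? ? ?.
  by move=> ?; split; lra.
move=> /negbT; rewrite -ltNge => ?; split; first lra.
by apply/negbTE; rewrite -ltNge; lra.
Qed.

Lemma shift_step_keep : shift (step l) (~~ m) = shift l (~~ m).
Proof. by levels. Qed.

Lemma shift_step_move : shift (step l) m = shift l (~~ m) + shift l m.
Proof. by levels => *; lra. Qed.

Lemma monodromy_step_keep : monodromy (step l) (~~ m) = monodromy l (~~ m).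
Proof. by levels. Qed.

Lemma monodromy_step_move c :
  monodromy (step l) m c = monodromy l m (monodromy l (~~ m) c).
Proof. by rewrite /step /= /perm_move /upd eqxx permM. Qed.

Lemma len_step_keep : len (step l) (~~ m) = len l (~~ m).
Proof. by levels. Qed.

Lemma len_step_move : len (step l) m = (len l m + len l (~~ m))%N.
Proof. by rewrite /step /= /upd eqxx. Qed.

End Step.

Lemma induced_base l s :
  positive l -> base l s -> base l (s + shift l (letter l s)).
Proof.
move=> lP; move: (lP true) (lP false); rewrite /base /letter /shift.
by case: (leP (width l true - width l false) s) => ? ? ? ?; lra.
Qed.

Section Dynamics.
Variable T : Q * R -> Q * R.

Definition returns l := forall c s, base l s ->
  iter (len l (letter l s)) T (c, s) = induced l (c, s).

Lemma letter_cases l x : let m := euclid_letter (width l) in x = m \/ x = ~~ m.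
Proof. by rewrite /=; case: x; case: euclid_letter; auto. Qed.

Lemma returns_step l :
  positive l -> positive (step l) -> returns l -> returns (step l).
Proof.
move=> lP sP ret c s bs.
have [bl ls] := base_step lP sP bs.
rewrite inducedE; have [e|e] := letter_cases l (letter (step l) s); last first.
  rewrite e len_step_keep // shift_step_keep // monodromy_step_keep //.
  by have := ret c s bl; rewrite inducedE ls.
have [bm lm] := base_step_mid lP sP bs e.
rewrite e len_step_move shift_step_move // monodromy_step_move iterD.
have := ret c s bl; rewrite {1}ls => ->.
rewrite inducedE ls -{1}lm ret // inducedE lm.
by rewrite addrA.
Qed.

(** (c, s) is reached in the tower over the domain of a letter x at level l: along
    the first i steps every point of that domain, started at the square d, is
    translated by the same t and crosses the same squares. *)
Definition covers l c s := exists d x i r0 t,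
  [/\ (i < len l x)%N, base l r0, letter l r0 = x, s = r0 + t &
      forall r, base l r -> letter l r = x -> iter i T (d, r) = (c, r + t)].

(** A floor of the tower over ~~ m remains one, over the new domains of both
    letters; a floor of the tower over m is put on top of the old tower over
    ~~ m. *)
Lemma covers_step l c s :
  positive l -> positive (step l) -> returns l -> covers l c s -> covers (step l) c s.
Proof.
move=> lP sP ret [d [x [i [r0 [t [ix b0 l0 -> itr]]]]]].
set m := euclid_letter (width l).
have [e|e] := letter_cases l x; rewrite -/m in e; rewrite e in ix l0 itr.
  have [bs ls] := mid_base_step lP sP b0 l0.
  exists ((monodromy l (~~ m))^-1%g d), m, (i + len l (~~ m))%N,
    (r0 - shift l (~~ m)), (t + shift l (~~ m)); split => //.
  - by rewrite len_step_move ltn_add2r.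
  - by rewrite [t + _]addrC addrA subrK.
  move=> r br lr; rewrite iterD.
  have [bl lrl] := base_step lP sP br; rewrite -/m in lrl.
  have := ret ((monodromy l (~~ m))^-1%g d) r bl; rewrite {1}lrl => ->.
  rewrite inducedE lrl permKV.
  have [bm lm] := base_step_mid lP sP br lr.
  by rewrite itr // [t + _]addrC addrA.
exists d, (letter (step l) r0), i, r0, t; split => //.
- apply: leq_trans ix _.
  have [->|->] := letter_cases l (letter (step l) r0); last by rewrite len_step_keep.
  by rewrite len_step_move leq_addl.
- exact: step_base.
by move=> r br _; have [bl lr] := base_step lP sP br; apply: itr => //; rewrite lr.
Qed.

(** Meaning of the sets of visits: each pair (d, y) in them is met, at the level
    l0, by the orbit that follows the corresponding word of level l. *)
Definition hits l0 l (f : visits Q) := forall r c d y, base l r ->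
  (d, y) \in f (letter l r) (monodromy l (letter l r) c) ->
  exists i r', [/\ (i <= len l (letter l r))%N, base l0 r', letter l0 r' = y &
                   iter i T (c, r) = (d, r')].

Lemma hits0 l0 : hits l0 l0 (visit0 (monodromy l0)).
Proof.
move=> r c d y br; rewrite /visit0 inE permK => /eqP[-> ->].
by exists 0%N, r.
Qed.

Lemma hits_step l0 l f : positive l -> positive (step l) -> returns l ->
  hits l0 l f ->
  hits l0 (step l) (visit_move (euclid_letter (width l)) (monodromy l) f).
Proof.
move=> lP sP ret hit r c d y br.
have [bl ls] := base_step lP sP br.
have hitN e : (e, y) \in f (~~ euclid_letter (width l))
      (monodromy l (~~ euclid_letter (width l)) c) ->
    exists i r', [/\ (i <= len l (~~ euclid_letter (width l)))%N, base l0 r',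
      letter l0 r' = y & iter i T (c, r) = (e, r')].
  by have := hit r c e y bl; rewrite ls.
have [e|e] := letter_cases l (letter (step l) r); last first.
  rewrite e len_step_keep // monodromy_step_keep //.
  by rewrite /visit_move /upd; case: eqP => [|_ /hitN //]; case: (euclid_letter _).
have [bm lm] := base_step_mid lP sP br e.
rewrite e len_step_move monodromy_step_move /visit_move /upd eqxx inE permK.
move=> /orP[in_m|/hitN[i [r' [il br' lr' it]]]]; last first.
  by exists i, r'; split=> //; apply: leq_trans il (leq_addl _ _).
have [|i [r' [il br' lr' it]]] :=
  hit _ (monodromy l (~~ euclid_letter (width l)) c) d y bm.
  by rewrite lm.
exists (i + len l (~~ euclid_letter (width l)))%N, r'; split=> //.
  by rewrite leq_add2r -lm.
by rewrite iterD; have := ret c r bl; rewrite {1}ls => ->; rewrite inducedE ls.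
Qed.
End Dynamics.

Section Orbit.
Variables (l0 : level) (K : nat).
Hypothesis len0 : forall x, len l0 x = 1%N.
Hypothesis tr0 : transitive_pair (monodromy l0).
Hypothesis ratio : forall k x, let w := iter k euclid_step (width l0) in
  0 < w x <= K%:R * w (~~ x).

Let T := induced l0.
Definition lev k := iter k step l0.
Definition total_width k := width (lev k) true + width (lev k) false.

Lemma width_lev k : width (lev k) = iter k euclid_step (width l0).
Proof. by elim: k => //= k <-. Qed.

Lemma lev_pos k : positive (lev k).
Proof. by move=> x; rewrite width_lev; have /andP[] := ratio k x. Qed.

Lemma lev_ratio k x : width (lev k) x <= K%:R * width (lev k) (~~ x).
Proof. by rewrite width_lev; have /andP[] := ratio k x. Qed.

Lemma lev_returns k : returns T (lev k).
Proof.
elim: k => [c s bs|k IH]; first by rewrite /lev /= len0.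
by apply: returns_step => //; [apply: lev_pos|apply: (lev_pos k.+1)].
Qed.

Lemma lev_covers k c s : base l0 s -> covers T (lev k) c s.
Proof.
move=> bs; elim: k => [|k IH].
  exists c, (letter l0 s), 0%N, s, 0; rewrite /lev /= len0 addr0; split => //.
  by move=> r _ _; rewrite addr0.
by apply: covers_step IH; [apply: lev_pos|apply: (lev_pos k.+1)|apply: lev_returns].
Qed.

(** The domain of each letter is as wide as [width] of the other letter, so this
    is the total length of the floors of the two towers. *)
Lemma lev_len k :
  (len (lev k) true)%:R * width (lev k) false +
  (len (lev k) false)%:R * width (lev k) true = total_width 0.
Proof.
elim: k => [|k <-]; first by rewrite /total_width /= !len0 !mul1r addrC.
rewrite /lev iterS -/(lev k) /step /euclid_step /upd /=.
by case: euclid_letter => /=; rewrite natrD; ring.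
Qed.

Lemma total_width_gt0 k : 0 < total_width k.
Proof. by rewrite addr_gt0 ?lev_pos. Qed.

Lemma total_width_le k x : total_width k <= K.+1%:R * width (lev k) x.
Proof.
rewrite -natr1 /total_width; have := lev_ratio k (~~ x); rewrite negbK mulrDl mul1r.
by case: x => /=; lra.
Qed.

Lemma lev_len_le k x : (len (lev k) x)%:R * total_width k <= K.+1%:R * total_width 0.
Proof.
have h : (len (lev k) x)%:R * width (lev k) (~~ x) <= total_width 0.
  rewrite -(lev_len k); have := lev_pos k; case: x => /= p.
    by rewrite lerDl mulr_ge0 // ltW.
  by rewrite lerDr mulr_ge0 // ltW.
apply: le_trans (ler_wpM2l (ler0n _ K.+1) h).
by rewrite mulrCA ler_wpM2l // total_width_le.
Qed.

Lemma total_width_step k :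
  exists x, total_width k.+1 = total_width k - width (lev k) x /\
            2 * width (lev k) x <= total_width k.
Proof.
rewrite /total_width {1 2}/lev iterS -/(lev k) /step /euclid_step /upd /euclid_letter /=.
case: ltP => h /=; first by exists false; split; lra.
by exists true; split; lra.
Qed.

Lemma total_width_half k : total_width k <= 2 * total_width k.+1.
Proof. by have [x [-> h]] := total_width_step k; lra. Qed.

(** Each step removes at least the fraction 1 / (K + 1) of the total width; this
    only gives a decay in 1 / k here, but any decay to 0 is enough. *)
Lemma total_width_decay k : (K + k)%:R * total_width k <= K%:R * total_width 0.
Proof.
elim: k => [|k]; first by rewrite addn0.
apply: le_trans; have [x [-> h]] := total_width_step k.
have := total_width_le k x; have := total_width_gt0 k; have := lev_pos k x.
rewrite addnS -!natr1 natrD; move: (total_width k) (width _ _) => S w w0 S0 Sw.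
have : 0 <= (k%:R : R) by []. have : 0 <= (K%:R : R) by [].
move: (K%:R : R) (k%:R : R) Sw => k1 k2 Sw k10 k20.
have : 0 <= k2 * w by rewrite mulr_ge0 // ltW.
nra.
Qed.

(** Since a step at most halves the total width, every scale is attained up to a
    factor 2. *)
Lemma total_width_scale eps : 0 < eps <= total_width 0 ->
  exists k, total_width k <= eps <= 2 * total_width k.
Proof.
move=> /andP[e0 e1].
have ex : exists k, total_width k <= eps.
  have [k hk] : exists k, K%:R * total_width 0 / eps <= (k%:R : R).
    exists (Num.bound (K%:R * total_width 0 / eps)); apply/ltW/archi_boundP.
    by rewrite divr_ge0 ?(ltW e0) // mulr_ge0 // ltW // total_width_gt0.
  exists k.+1; rewrite leNgt; apply/negP => lt.
  suff : K%:R * total_width 0 < (K + k.+1)%:R * total_width k.+1.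
    by rewrite ltNge total_width_decay.
  move: hk; rewrite ler_pdivrMr // => hk; apply: le_lt_trans hk _.
  apply: (@lt_le_trans _ _ (k.+1%:R * eps)); first by rewrite ltr_pM2r ?ltr_nat.
  by apply: ler_pM => //; [apply: ltW|rewrite ler_nat leq_addl|apply: ltW].
have := ex_minnP ex => -[[|k] ke kmin]; first by exists 0%N; lra.
exists k.+1; rewrite ke /=; apply: le_trans (total_width_half k).
by rewrite leNgt; apply/negP => /ltW/kmin; rewrite ltnn.
Qed.

(** K + 1 subtractions in a row of the same width would exhaust the larger one,
    which is at most K times the smaller one. *)
Lemma letters_switch i :
  exists2 j, (j < K.+1)%N &
    euclid_letter (width (lev (i + j))) != euclid_letter (width (lev i)).
Proof.
set m := euclid_letter (width (lev i)).
apply: contrapT => no.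
have same j : (j < K.+1)%N -> euclid_letter (width (lev (i + j))) = m.
  by move=> jK; apply/eqP/negPn/negP => ne; apply: no; exists j.
have run j : (j <= K.+1)%N ->
    width (lev (i + j)) m = width (lev i) m - j%:R * width (lev i) (~~ m) /\
    width (lev (i + j)) (~~ m) = width (lev i) (~~ m).
  elim: j => [|j IH] jK; first by rewrite addn0 mul0r subr0.
  have [e1 e2] := IH (ltnW jK).
  rewrite addnS /lev iterS -/(lev _) /step /= /euclid_step same // /upd eqxx.
  by rewrite -natr1 e1 e2; split; [ring|case: (m) e2].
have [e _] := run _ (leqnn _).
have := lev_pos (i + K.+1) m; rewrite e -natr1.
by have := lev_ratio i m; have := lev_pos i (~~ m); lra.
Qed.

Fixpoint lev_visits k j : visits Q :=
  if j is j'.+1 then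
    visit_move (euclid_letter (width (lev (k + j')))) (monodromy (lev (k + j')))
      (lev_visits k j')
  else visit0 (monodromy (lev k)).

Lemma lev_hits k j : hits T (lev k) (lev (k + j)) (lev_visits k j).
Proof.
elim: j => [|j IH]; first by rewrite addn0; apply: hits0.
rewrite addnS; apply: hits_step => //; first exact: lev_pos.
  exact: (lev_pos (k + j).+1).
exact: lev_returns.
Qed.

Lemma lev_transitive k : transitive_pair (monodromy (lev k)).
Proof. by elim: k => // k IH; apply: transitive_move. Qed.

Lemma lev_full k x c : lev_visits k (full_time Q K.+1) x c = [set: Q * bool].
Proof.
apply: (@full_visits _ (fun i => euclid_letter (width (lev (k + i))))
  (fun i => monodromy (lev (k + i)))).
- by move=> i; rewrite addnS.
- by [].
- by rewrite addn0.
- by rewrite addn0; apply: lev_transitive.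
by move=> i; have [j jK] := letters_switch (k + i); exists j => //; rewrite addnA.
Qed.

(** Let k be a level of size total_width 0 / n.  The orbit climbs to the end of
    its tower of level k + J, then follows a whole word of that level and so
    meets every pair (square, letter) of level k, in particular the one whose
    tower contains (c, s); the two orbits then run parallel to each other.  All
    words involved have O(n) letters, J being independent of n. *)
Lemma orbit_dense : exists2 C : R, 0 < C &
  forall n, (0 < n)%N -> forall c0 s0 c s, base l0 s0 -> base l0 s ->
  exists i s', [/\ i%:R <= C * n%:R, iter i T (c0, s0) = (c, s') &
                   `|s' - s| <= total_width 0 / n%:R].
Proof.
pose J := full_time Q K.+1.
have [P P0 PE] : exists2 P : R, 0 < P & P = 2 ^+ J by exists (2 ^+ J); rewrite ?exprn_gt0.
pose B : R := K.+1%:R * (2 * P).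
have B0 : 0 < B by rewrite !mulr_gt0.
exists (3 * B) => [|n n0 c0 s0 c s b0 b]; first by rewrite mulr_gt0.
have n0R : 0 < (n%:R : R) by rewrite ltr0n.
have [k /andP[k1 k2]] : exists k,
    total_width k <= total_width 0 / n%:R <= 2 * total_width k.
  apply: total_width_scale; rewrite divr_gt0 ?total_width_gt0 //= ler_pdivrMr //.
  by rewrite ler_peMr ?ler1n // ltW // total_width_gt0.
have decay j : total_width k <= 2 ^+ j * total_width (k + j).
  elim: j => [|j IH]; first by rewrite mul1r addn0.
  apply: le_trans IH _; rewrite addnS exprSr -mulrA ler_wpM2l ?exprn_ge0 //.
  exact: total_width_half.
have lenB j x : (j <= J)%N -> (len (lev (k + j)) x)%:R <= B * n%:R.
  move=> jJ; rewrite -(ler_pM2r (total_width_gt0 (k + j))).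
  apply: le_trans (lev_len_le _ _) _; rewrite /B -!mulrA ler_wpM2l //.
  have h1 : total_width 0 <= 2 * total_width k * n%:R by rewrite -ler_pdivrMr.
  apply: le_trans h1 _; rewrite -mulrA ler_wpM2l //.
  rewrite [P * _]mulrCA [total_width k * _]mulrC ler_wpM2l //.
  apply: le_trans (decay j) _; rewrite PE ler_wpM2r ?(ltW (total_width_gt0 _)) //.
  by apply: ler_weXn2l jJ; lra.
have [d [x [i [r0 [t [ix br lr s0E itr]]]]]] := lev_covers (k + J) c0 b0.
have := itr r0 br lr; rewrite -s0E => it0.
have b1 := induced_base (lev_pos _) br; rewrite lr in b1.
have ret := @lev_returns (k + J)%N d _ br; rewrite inducedE lr in ret.
have [d2 [y [i2 [r2 [t2 [iy2 br2 lr2 -> itr2]]]]]] := lev_covers k c b.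
have [|i1 [r' [i1x br' lr' it1]]] :=
  @lev_hits k J _ (monodromy (lev (k + J)) x d) d2 y b1.
  by rewrite lev_full inE.
exists (i2 + (i1 + (len (lev (k + J)) x - i)))%N, (r' + t2); split.
- have h1 := lenB J x (leqnn _).
  have h2 := lenB J (letter (lev (k + J)) (r0 + shift (lev (k + J)) x)) (leqnn _).
  have := lenB 0%N y (leq0n _); rewrite addn0 => h3.
  have e1 : (i2%:R : R) <= (len (lev k) y)%:R by rewrite ler_nat ltnW.
  have e2 : (i1%:R : R) <=
      (len (lev (k + J)) (letter (lev (k + J)) (r0 + shift (lev (k + J)) x)))%:R.
    by rewrite ler_nat.
  have e3 : ((len (lev (k + J)) x - i)%:R : R) <= (len (lev (k + J)) x)%:R.
    by rewrite ler_nat leq_subr.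
  by rewrite !natrD; lra.
- have it2 : iter (len (lev (k + J)) x - i) T (c0, s0) =
      (monodromy (lev (k + J)) x d, r0 + shift (lev (k + J)) x).
    by rewrite -it0 -iterD subnK ?ret // ltnW.
  by rewrite iterD (iterD i1) it2 it1 itr2.
rewrite opprD addrACA subrr addr0; apply: le_trans k1.
by move: br' br2; rewrite /base /total_width ler_norml => /andP[? ?] /andP[? ?]; lra.
Qed.
End Orbit.
End Induction.

(** * Continued fractions and the subtractive Euclidean algorithm *)

Section ContinuedFraction.
Variable R : realType.
Implicit Types a : R.

Lemma irrational_sub_floor a : irrational a -> 0 < a - (Num.floor a)%:~R < 1.
Proof.
move=> irr; have /andP[le lt] := floor_itv a.
rewrite intrD in lt; rewrite ltrBlDl lt andbT subr_gt0 lt_neqAle le andbT.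
by apply/eqP => e; apply: irr; exists (Num.floor a)%:~R => //; rewrite ratr_int.
Qed.

Lemma irrational_inv_sub_floor a :
  irrational a -> irrational (a - (Num.floor a)%:~R)^-1.
Proof.
move=> irr [q _ qE]; apply: irr; exists (q^-1 + (Num.floor a)%:~R) => //.
by rewrite rmorphD /= fmorphV /= qE invrK ratr_int subrK.
Qed.

Variable a : R.
Hypothesis irr : irrational a.

Lemma irrational_tail k : irrational (cf_tail a k).
Proof. by elim: k => //= k IH; apply: irrational_inv_sub_floor. Qed.

Lemma cf_tailS k :
  (cf_tail a k.+1)^-1 = cf_tail a k - (Num.floor (cf_tail a k))%:~R.
Proof. by rewrite /cf_tail iterS invrK. Qed.

Lemma cf_tail_gt1 k : 1 < cf_tail a k.+1.
Proof.
have /andP[h0 h1] := irrational_sub_floor (@irrational_tail k).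
by rewrite -[cf_tail _ _]invrK cf_tailS invf_gt1.
Qed.

Lemma cf_digit_ge1 k : 1 <= cf_digit a k.+1.
Proof. by rewrite /cf_digit floor_ge_int ltW // cf_tail_gt1. Qed.

Lemma cf_tail_digit k : cf_tail a k = (cf_digit a k)%:~R + (cf_tail a k.+1)^-1.
Proof. by rewrite cf_tailS addrC subrK. Qed.

(** The ratio of the widths runs through the numbers [x_k - j], where x_k is the
    k-th tail of the continued fraction of a and j is smaller than its digit,
    and through their inverses. *)
Definition euclid_regular (rho : R) := exists k (j : int),
  0 <= j < cf_digit a k /\ (rho = cf_tail a k - j%:~R \/ rho^-1 = cf_tail a k - j%:~R).

(** For a negative a = a_0 + 1 / x_1, the algorithm is run on
    |a| = (- a_0 - 1) + 1 - 1 / x_1; after the integral part is exhausted, it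
    passes from 1 - 1 / x_1 to x_1 - 1, which is regular. *)
Definition euclid_transient m0 (rho : R) :=
  exists2 m : nat, (m <= m0)%N & rho = m%:R + 1 - (cf_tail a 1)^-1.

Lemma regular_gt1 k (j : int) : 0 <= j < cf_digit a k -> 1 < cf_tail a k - j%:~R.
Proof.
move=> /andP[_ jk]; rewrite cf_tail_digit.
have : 0 < (cf_tail a k.+1)^-1 by rewrite invr_gt0 (lt_trans _ (cf_tail_gt1 k)).
have : (j + 1)%:~R <= (cf_digit a k)%:~R :> R by rewrite ler_int lezD1.
by rewrite intrD; lra.
Qed.

(** Either j + 1 is still below the digit, or the difference is the inverse of
    the next tail. *)
Lemma regular_sub1 k (j : int) y : 0 <= j < cf_digit a k ->
  y = cf_tail a k - j%:~R -> euclid_regular (y - 1) /\ euclid_regular (y - 1)^-1.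
Proof.
move=> /andP[j0 jk] ->.
suff : exists k' (j' : int), 0 <= j' < cf_digit a k' /\
    (cf_tail a k - j%:~R - 1 = cf_tail a k' - j'%:~R \/
    (cf_tail a k - j%:~R - 1)^-1 = cf_tail a k' - j'%:~R).
  move=> [k' [j' [j'P H]]]; split; exists k', j'; split => //.
  by rewrite invrK; case: H; auto.
have [lt|ge] := ltP (j + 1) (cf_digit a k).
  exists k, (j + 1); rewrite lt addr_ge0 //; split => //.
  by left; rewrite intrD; ring.
exists k.+1, 0; split; first by rewrite lexx /= (lt_le_trans _ (cf_digit_ge1 k)).
right; rewrite subr0 -[RHS]invrK cf_tailS; congr (_^-1).
have -> : Num.floor (cf_tail a k) = j + 1 by apply/le_anti; rewrite ge lezD1.
by rewrite intrD; ring.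
Qed.

Lemma transient_itv : 0 < 1 - (cf_tail a 1)^-1 < 1.
Proof.
have := cf_tail_gt1 0 => h; have h0 : 0 < cf_tail a 1 by lra.
by rewrite subr_gt0 invf_lt1 // h /= ltrBlDr ltrDl invr_gt0.
Qed.

Definition euclid_state m0 (w : bool -> R) :=
  [/\ 0 < w false, 0 < w true &
      euclid_regular (w true / w false) \/ euclid_transient m0 (w true / w false)].

Lemma euclid_state_step m0 w : euclid_state m0 w -> euclid_state m0 (euclid_step w).
Proof.
move=> [wf wt st]; have wf0 : w false != 0 by rewrite gt_eqF.
have wt0 : w true != 0 by rewrite gt_eqF.
have [small|] := ltP (w true / w false) 1.
  have lt : w true < w false by rewrite ltr_pdivrMr ?mul1r in small.
  have d0 : w false - w true != 0 by rewrite subr_eq0 gt_eqF.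
  have e : (w true / (w false - w true)) = ((w true / w false)^-1 - 1)^-1.
    by field; rewrite wf0 wt0 mulN1r d0.
  have nlt : w false < w true = false by rewrite ltNge (ltW lt).
  rewrite /euclid_state /euclid_step /euclid_letter nlt /upd /= e.
  split; rewrite ?subr_gt0 //; left.
  case: st => [[k [j [jk [E|E]]]]|[m mm0 E]].
  - by have := regular_gt1 jk; rewrite -E; lra.
  - by have [] := regular_sub1 jk E.
  have /andP[t0 t1] := transient_itv; case: m E mm0 => [|m] E mm0; last first.
    by move: E; rewrite -natr1; have : 0 <= (m%:R : R) by []; lra.
  have := cf_tail_gt1 0 => h; rewrite E add0r.
  have -> : ((1 - (cf_tail a 1)^-1)^-1 - 1)^-1 = cf_tail a 1 - 1.
    by field; rewrite !gt_eqF ?subr_gt0 //; lra.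
  have [||] := @regular_sub1 1 0 (cf_tail a 1); rewrite ?subr0 //.
  by rewrite lexx /= (lt_le_trans _ (cf_digit_ge1 0)).
rewrite le_eqVlt => /orP[/eqP e1|big].
  case: st => [[k [j [jk [E|E]]]]|[m mm0 E]].
  - by have := regular_gt1 jk; rewrite -E -e1 ltxx.
  - by have := regular_gt1 jk; rewrite -E -e1 invr1 ltxx.
  exfalso; apply: (@irrational_tail 1); exists m%:R^-1 => //.
  have e : (cf_tail a 1)^-1 = m%:R by move: E; rewrite -e1; lra.
  by rewrite -[RHS]invrK e -(ratr_nat R m) fmorphV.
have gt : w false < w true by rewrite ltr_pdivlMr ?mul1r in big.
have e : ((w true - w false) / w false) = w true / w false - 1.
  by field; rewrite wf0.
rewrite /euclid_state /euclid_step /euclid_letter gt /upd /= e.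
split; rewrite ?subr_gt0 //.
case: st => [[k [j [jk [E|E]]]]|[[|m] mm0 E]].
- by left; have [] := regular_sub1 jk E.
- have := regular_gt1 jk; rewrite -E invf_gt1 ?divr_gt0 //; lra.
- by have := transient_itv; move: E; rewrite add0r; lra.
by right; exists m; [apply: ltnW|rewrite E -natr1; ring].
Qed.

Lemma euclid_state_bound (M : int) m0 : (forall k, `|cf_digit a k| <= M) ->
  exists K : nat, forall w, euclid_state m0 w ->
  forall x, 0 < w x <= K%:R * w (~~ x).
Proof.
move=> dM; pose t := 1 - (cf_tail a 1)^-1.
have /andP[t0 t1] := transient_itv; rewrite -/t in t0 t1.
have M0 : 0 <= (M%:~R : R) by rewrite ler0z; apply: le_trans (dM 0%N).
pose B : R := M%:~R + 1 + m0%:R + t^-1.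
have B1 : 1 <= B by rewrite /B -addrA -addrA addrCA lerDl !addr_ge0 // invr_ge0 ltW.
exists (Num.bound B) => w [wf wt st].
have BK : B <= (Num.bound B)%:R by apply/ltW/archi_boundP; lra.
have ti : 0 < t^-1 by rewrite invr_gt0.
have m00 : 0 <= (m0%:R : R) by [].
suff [h1 h2] : w true / w false <= B /\ (w true / w false)^-1 <= B.
  have h3 : w true <= (Num.bound B)%:R * w false.
    by rewrite -ler_pdivrMr //; apply: le_trans BK.
  have h4 : w false <= (Num.bound B)%:R * w true.
    by rewrite -ler_pdivrMr // -invf_div; apply: le_trans BK.
  by case; apply/andP.
have small k (j : int) : 0 <= j < cf_digit a k -> cf_tail a k - j%:~R <= M%:~R + 1.
  move=> /andP[j0 _]; rewrite cf_tail_digit.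
  have : (0 : R) <= j%:~R by rewrite ler0z.
  have : (cf_digit a k)%:~R <= M%:~R :> R.
    by rewrite ler_int; apply: le_trans (ler_norm _) (dM k).
  have : (cf_tail a k.+1)^-1 <= 1.
    by rewrite invf_le1 ?ltW ?cf_tail_gt1 ?(lt_trans _ (cf_tail_gt1 k)).
  by lra.
have rho0 : 0 < w true / w false by rewrite divr_gt0.
case: st => [[k [j [jk E]]]|[m mm0 E]].
  have h1 := regular_gt1 jk; have h2 := small _ _ jk.
  case: E => E.
    rewrite E; split; first by rewrite /B; lra.
    by apply: le_trans B1; rewrite invf_le1 ?ltW //; lra.
  rewrite E; split; last by rewrite /B; lra.
  by rewrite -[_ / _]invrK E; apply: le_trans B1; rewrite invf_le1 ?ltW //; lra.
have mm : (m%:R : R) <= m0%:R by rewrite ler_nat.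
have m_ge0 : 0 <= (m%:R : R) by [].
rewrite E -addrA -/t; split; first by rewrite /B; lra.
apply: (@le_trans _ _ t^-1); last by rewrite /B; lra.
by rewrite lef_pV2 ?posrE //; lra.
Qed.

Lemma euclid_state_init (w : bool -> R) : 0 < w false ->
  w true / w false = `|a| -> exists m0, euclid_state m0 w.
Proof.
move=> wf wE; have a0 : a != 0.
  by apply/eqP => e; apply: irr; exists 0; rewrite // rmorph0.
have wt : 0 < w true.
  by rewrite -(divfK (lt0r_neq0 wf) (w true)) wE mulr_gt0 ?normr_gt0.
have a1 : a = (cf_digit a 0)%:~R + (cf_tail a 1)^-1 := cf_tail_digit 0.
have h0 : 0 < (cf_tail a 1)^-1 by rewrite invr_gt0 (lt_trans _ (cf_tail_gt1 0)).
have h1 : (cf_tail a 1)^-1 < 1 by have := transient_itv; lra.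
have [apos|aneg] := ltP 0 a.
  exists 0%N; split => //; left; rewrite wE gtr0_norm //.
  have : 0 <= cf_digit a 0 by rewrite floor_ge0 /= ltW.
  rewrite le_eqVlt => /orP[/eqP e|dpos].
    have ea : a = (cf_tail a 1)^-1 by rewrite [LHS]a1 -e add0r.
    exists 1%N, 0; rewrite lexx (lt_le_trans _ (cf_digit_ge1 0)) //; split => //.
    by right; rewrite subr0 [in LHS]ea invrK.
  by exists 0%N, 0; rewrite lexx dpos subr0; split => //; left.
have {}aneg : a < 0 by rewrite lt_neqAle a0.
have dneg : cf_digit a 0 < 0 by rewrite floor_lt0.
exists `|cf_digit a 0|%N; split => //; right.
exists (`|cf_digit a 0|.-1)%N; first exact: leq_pred.
have dabs : (`|cf_digit a 0|.-1%:R + 1 : R) = - (cf_digit a 0)%:~R.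
  rewrite natr1 prednK ?absz_gt0 ?lt_eqF //.
  by rewrite -intrN -ltr0_norm // -abszE.
by rewrite dabs wE ltr0_norm // {1}a1; ring.
Qed.

(** q and q' are the denominators of the k-th and (k - 1)-th convergents, and X is
    the product of the tails x_1, ..., x_(k + 1). *)
Lemma convergents k : exists (q q' p : int) (X : R),
  [/\ 0 < q, 0 <= q', 0 < X, `|q%:~R * a - p%:~R| = X^-1 &
      q%:~R * cf_tail a k.+1 + q'%:~R = X].
Proof.
suff [q [q' [p [p' [X [X' [s []]]]]]]] : exists (q q' p p' : int) (X X' s : R),
  [/\ [/\ 0 < q, 0 <= q', 0 < X', X = X' * cf_tail a k.+1 & `|s| = 1],
      q%:~R * a - p%:~R = s / X, q'%:~R * a - p'%:~R = - s / X' &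
      q%:~R * cf_tail a k.+1 + q'%:~R = X].
  move=> [q0 q'0 X'0 XE s1] e1 e2 e3; have := cf_tail_gt1 k => t1.
  have X0 : 0 < X by rewrite XE mulr_gt0 //; lra.
  by exists q, q', p, X; split => //;
    rewrite e1 normrM s1 mul1r ger0_norm // ltW ?invr_gt0.
elim: k => [|k [q [q' [p [p' [X [X' [s [[q0 q'0 X'0 XE s1] e1 e2 e3]]]]]]]]].
  exists 1, 0, (cf_digit a 0), 1, (cf_tail a 1), 1, 1; split; rewrite ?normr1 ?mul1r //.
  - by rewrite cf_tailS.
  - by rewrite mul0r sub0r invr1 mulr1.
  by rewrite addr0.
have t1 := cf_tail_gt1 k; have t2 := cf_tail_gt1 k.+1.
have X0 : 0 < X by rewrite XE mulr_gt0 //; lra.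
have tE := cf_tail_digit k.+1.
have d1 := cf_digit_ge1 k.
exists (cf_digit a k.+1 * q + q'), q, (cf_digit a k.+1 * p + p'), p,
  (X * cf_tail a k.+2), X, (- s); split.
- split => //; rewrite ?normrN //; last exact: ltW.
  by rewrite ltr_wpDr // mulr_gt0 // (lt_le_trans _ d1).
- rewrite !intrD !intrM.
  have -> : ((cf_digit a k.+1)%:~R * q%:~R + q'%:~R) * a -
      ((cf_digit a k.+1)%:~R * p%:~R + p'%:~R) =
      (cf_digit a k.+1)%:~R * (q%:~R * a - p%:~R) + (q'%:~R * a - p'%:~R) by ring.
  have -> : (cf_digit a k.+1)%:~R = cf_tail a k.+1 - (cf_tail a k.+2)^-1 :> R.
    by rewrite tE addrK.
  by rewrite e1 e2 XE; field; rewrite !gt_eqF //; lra.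
- by rewrite opprK.
rewrite intrD intrM -e3 tE; field.
by rewrite gt_eqF //; lra.
Qed.

End ContinuedFraction.

(** For the k-th convergent p / q, the distance |q a - p| is 1 / X with
    X >= q x_(k + 1); the gap thus bounds x_(k + 1) by 1 / delta. *)
Lemma badly_approximable_of_gap (R : realType) (a delta : R) : 0 < delta ->
  (forall p q : int, 0 < q -> delta <= `|q%:~R * a - p%:~R| * q%:~R) ->
  badly_approximable a.
Proof.
move=> d0 gap.
have irr : irrational a.
  move=> /rationalP[p [b aE]]; case: b aE => [|b] aE.
    have := gap 0 1 isT; rewrite aE invr0 mulr0 mulr0 subr0 normr0 mul0r.
    by rewrite leNgt d0.
  have := gap p (Posz b.+1) isT.
  have e : (Posz b.+1)%:~R * (p%:~R / b.+1%:R) = p%:~R :> R.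
    by rewrite mulrC divfK // pnatr_eq0.
  by rewrite aE e subrr normr0 mul0r leNgt d0.
split => //.
exists (`|cf_digit a 0| + Num.floor (delta^-1)) => -[|k].
  by rewrite lerDl floor_ge0 invr_ge0 ltW.
rewrite ger0_norm ?(le_trans _ (cf_digit_ge1 irr k)) //.
apply: le_trans (_ : Num.floor (delta^-1) <= _); last by rewrite lerDr.
apply: (@le_floor _ (cf_tail a k.+1)).
have [q [q' [p [X [q0 q'0 X0 e1 e2]]]]] := convergents irr k.
have t1 := cf_tail_gt1 irr k.
move: (cf_tail a k.+1) t1 e2 => t t1 e2.
have t0 : 0 < t by apply: lt_trans t1.
have q'R : (0 : R) <= q'%:~R by rewrite ler0z.
have := gap p q q0; rewrite e1 mulrC ler_pdivlMr // => le.
rewrite -[t]invrK lef_pV2 ?posrE ?invr_gt0 // -[t^-1]mul1r ler_pdivlMr //.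
have qR : (0 : R) < q%:~R by rewrite ltr0z.
rewrite -(ler_pM2r qR) mul1r -mulrA; apply: le_trans le.
by rewrite ler_wpM2l ?(ltW d0) // -e2 mulrC lerDl.
Qed.

Lemma badly_approximable_euclid (R : realType) (a : R) (w : bool -> R) :
  badly_approximable a -> 0 < w false -> w true / w false = `|a| ->
  exists K : nat, forall k x,
    let wk := iter k (@euclid_step R) w in 0 < wk x <= K%:R * wk (~~ x).
Proof.
move=> [irr [M dM]] wf wE.
have [m0 st] := euclid_state_init irr wf wE.
have [K KP] := euclid_state_bound irr m0 dM.
exists K => k x; apply: KP.
by elim: k => //= k IH; apply: euclid_state_step.
Qed.

(** * A superdense geodesic has a badly approximable slope *)

(** Connectedness of the half-line: consider the supremum of the t such that P
    holds on [0, t]. *)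
Lemma real_induction (R : realType) (P : R -> Prop) :
  P 0 ->
  (forall t : R, 0 < t -> (forall s : R, 0 <= s < t -> P s) -> P t) ->
  (forall t : R, 0 <= t -> P t ->
    exists2 d : R, 0 < d & forall s : R, t <= s <= t + d -> P s) ->
  forall t : R, 0 <= t -> P t.
Proof.
move=> P0 left right t0 t0_ge0; apply: contrapT => nP.
pose E := [set t : R | 0 <= t /\ forall s, 0 <= s <= t -> P s]%classic.
have E0 : E 0 by split => // s; rewrite -eq_le => /eqP <-.
have Eub : ubound E t0.
  move=> t [t_ge0 Pt]; rewrite leNgt; apply/negP => lt.
  by apply/nP/Pt; rewrite t0_ge0 ltW.
have supE : has_sup E by split; [exists 0|exists t0].
have sup0 : 0 <= sup E by apply: ub_le_sup => //; exists t0.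
have Plt s : 0 <= s < sup E -> P s.
  move=> /andP[s0 lt]; have e0 : 0 < sup E - s by rewrite subr_gt0.
  have [e [_ Pe]] := sup_adherent e0 supE.
  by rewrite subKr => se; apply: Pe; rewrite s0 ltW.
have Psup : P (sup E).
  by move: sup0; rewrite le_eqVlt => /orP[/eqP <- //|pos]; apply: left.
have [d d0 Pd] := right _ sup0 Psup.
have : E (sup E + d).
  split; first by rewrite addr_ge0 // ltW.
  move=> s /andP[s0 sd]; have [lt|ge] := ltP s (sup E).
    by apply: Plt; rewrite s0.
  by apply: Pd; rewrite ge.
move=> /(ub_le_sup _) -/(_ (ex_intro _ t0 Eub)).
by rewrite gerDl leNgt d0.
Qed.

Lemma int_between (R : realType) (k : R) : k \is a Num.int -> ~ (0 < k < 1).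
Proof.
move=> /intrP[m ->]; rewrite ltr0z ltrz1 => /andP[m0 m1].
by move: m0 m1; case: m => [[|m]|m].
Qed.

Lemma solve_mod1 (R : realType) (a : int) (th : R) : a != 0 ->
  exists2 x, 0 <= x <= 1 & a%:~R * x - th \is a Num.int.
Proof.
move=> a0; pose s : R := (sgz a)%:~R; pose f := s * th - (Num.floor (s * th))%:~R.
have /andP[f0 f1] := floor_itv (s * th); rewrite intrD in f1.
have aR : (0 : R) < `|a|%:~R by rewrite ltr0z normr_gt0.
have a1 : (1 : R) <= `|a|%:~R by rewrite ler1z -gtz0_ge1 normr_gt0.
have fE : 0 <= f < 1 by rewrite /f; lra.
exists (f / `|a|%:~R).
  case/andP: fE => fE1 fE2; rewrite divr_ge0 ?(ltW aR) //=.
  by rewrite ler_pdivrMr // mul1r ltW // (lt_le_trans fE2).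
have s2 : s * s = 1.
  rewrite /s; have [->|->] : sgz a = 1 \/ sgz a = -1.
    by move: a0; case: sgzP => // _ _; [left|right].
  by rewrite mulr1.
  by rewrite intrN mulrNN mulr1.
have ds : a%:~R / `|a|%:~R = s.
  rewrite {1}[a]intEsg intrM abszE -/s mulfK // gt_eqF //.
have -> : a%:~R * (f / `|a|%:~R) - th = - (s * (Num.floor (s * th))%:~R).
  rewrite mulrCA ds /f mulrBl mulrAC s2 mul1r; ring.
by rewrite rpredN rpredM // intr_int.
Qed.

Section Surface.
Variables (R : realType) (S : polysquare_surface).
Implicit Types (p q : surface_point R S) (c d : squares S) (l t : R).

(** The surface projects to the unit torus. *)
Lemma same_point_int p q : same_point p q ->
  p.1.2 - q.1.2 \is a Num.int /\ p.2 - q.2 \is a Num.int.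
Proof.
elim => {p q} [p q [c y _|c x _]|p|p q _ [i j]|p q r _ [i j] _ [i' j']] /=.
- by rewrite subr0 subrr.
- by rewrite subr0 subrr.
- by rewrite !subrr.
- by rewrite -opprB rpredN -[q.2 - _]opprB rpredN.
by split; [rewrite -(subrKA q.1.2)|rewrite -(subrKA q.2)]; rewrite rpredD.
Qed.

Lemma joined_lipschitz p q l : joined p q l -> 0 <= l /\
  exists i j : R, [/\ i \is a Num.int, j \is a Num.int,
    `|q.1.2 - p.1.2 - i| <= l & `|q.2 - p.2 - j| <= l].
Proof.
elim => {p q l} [p q /same_point_int[i j]|c x y x' y' _ _|
    p q r l m _ [l0 [i [j [iI jI hi hj]]]] _ [m0 [i' [j' [i'I j'I hi' hj']]]]].
- split => //; exists (q.1.2 - p.1.2), (q.2 - p.2).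
  rewrite !subrr normr0; split => //.
    by rewrite -opprB rpredN.
  by rewrite -opprB rpredN.
- split; first exact: sqrtr_ge0.
  exists 0, 0; rewrite /= !subr0; split => //; rewrite -sqrtr_sqr ler_wsqrtr //.
    by rewrite lerDl sqr_ge0.
  by rewrite lerDr sqr_ge0.
split; first exact: addr_ge0.
exists (i + i'), (j + j'); split; rewrite ?rpredD //.
  have -> : r.1.2 - p.1.2 - (i + i') = (q.1.2 - p.1.2 - i) + (r.1.2 - q.1.2 - i') by ring.
  by apply: le_trans (ler_normD _ _) _; apply: lerD.
have -> : r.2 - p.2 - (j + j') = (q.2 - p.2 - j) + (r.2 - q.2 - j') by ring.
by apply: le_trans (ler_normD _ _) _; apply: lerD.
Qed.

Lemma joined_connected p q : on_surface p -> on_surface q -> exists l, joined p q l.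
Proof.
move: p q => [[c x] y] [[d x'] y']; rewrite /on_surface /= => cp dq.
have /connectP[s] := surface_connected c d.
elim: s c x y cp => [|b s IH] c x y cp /=.
  by move=> _ e; subst d; eexists; apply: JoinedSegment.
move=> /andP[/orP[/eqP e|/eqP e] bs] ed.
  have u : in_unit_square (0 : R) 0 by split; rewrite lexx ler01.
  have [l lP] := IH b 0 0 u bs ed.
  have u' : in_unit_square (1 : R) 0 by split; rewrite lexx ler01.
  eexists; apply: JoinedTrans (JoinedSegment c cp u') _.
  apply: JoinedTrans (JoinedSame _) lP; apply: rst_step.
  by rewrite -e; apply: GluedV; rewrite lexx ler01.
have u : in_unit_square (0 : R) 0 by split; rewrite lexx ler01.
have [l lP] := IH b 0 0 u bs ed.
have u' : in_unit_square (0 : R) 1 by split; rewrite lexx ler01.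
eexists; apply: JoinedTrans (JoinedSegment c cp u') _.
apply: JoinedTrans (JoinedSame _) lP; apply: rst_step.
by rewrite -e; apply: GluedH; rewrite lexx ler01.
Qed.

Lemma flat_dist_le p q l : joined p q l -> flat_dist p q <= l.
Proof.
move=> J; apply: ge_inf => //; exists 0 => m /joined_lipschitz[]//.
Qed.

Lemma flat_dist_lt p q l : on_surface p -> on_surface q -> flat_dist p q < l ->
  exists2 m, joined p q m & m < l.
Proof.
move=> pS qS lt; have [m0 m0P] := joined_connected pS qS.
have e0 : 0 < l - flat_dist p q by rewrite subr_gt0.
have hinf : has_inf [set m | joined p q m]%classic.
  by split; [exists m0|exists 0 => m /joined_lipschitz[]].
have [m mP] := inf_adherent e0 hinf; rewrite /flat_dist addrC subrK => ml.
by exists m.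
Qed.

Section Geodesic.
Variables (L : R -> surface_point R S) (u v : R).
Hypothesis geo : half_infinite_geodesic L u v.

(** The projection of the geodesic to the torus is the line of direction (u, v). *)
Lemma geodesic_torus t : 0 <= t ->
  (L t).1.2 - (L 0).1.2 - t * u \is a Num.int /\
  (L t).2 - (L 0).2 - t * v \is a Num.int.
Proof.
have [_ _ fwd bwd] := geo.
pose A t := (L t).1.2 - (L 0).1.2 - t * u; pose B t := (L t).2 - (L 0).2 - t * v.
suff : forall t, 0 <= t -> A t \is a Num.int /\ B t \is a Num.int by apply.
have straight a b : a <= b -> straight_on L u v a b -> forall s r,
    a <= s <= b -> a <= r <= b -> A s - A r \is a Num.int /\ B s - B r \is a Num.int.
  move=> ab [c [x [y st]]] s r sI rI.
  have [_ /same_point_int /= [s1 s2]] := st s sI.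
  have [_ /same_point_int /= [r1 r2]] := st r rI.
  split.
    have -> : A s - A r =
        ((L s).1.2 - (x + (s - a) * u)) - ((L r).1.2 - (x + (r - a) * u)).
      by rewrite /A; ring.
    by rewrite rpredB.
  have -> : B s - B r =
      ((L s).2 - (y + (s - a) * v)) - ((L r).2 - (y + (r - a) * v)).
    by rewrite /B; ring.
  by rewrite rpredB.
apply: real_induction.
- by rewrite /A /B !subrr !mul0r !subr0.
- move=> {}t t0 Pt; have [d /andP[d0 dt] st] := bwd t t0.
  have le : t - d <= t by lra.
  have [||h1 h2] := straight _ _ le st t (t - d); try lra.
  have [|h3 h4] := Pt (t - d); first lra.
  split; first by rewrite -[A t](subrK (A (t - d))) rpredD.
  by rewrite -[B t](subrK (B (t - d))) rpredD.
move=> {}t t0 [Pt1 Pt2]; have [d d0 st] := fwd t t0.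
exists d => // s sI; have le : t <= t + d by lra.
have [||h1 h2] := straight _ _ le st s t; try lra.
split; first by rewrite -[A s](subrK (A t)) rpredD.
by rewrite -[B s](subrK (B t)) rpredD.
Qed.

(** In a time proportional to |a| + |b|, the geodesic comes so close to a point
    where a x + b y differs by 1/2 mod 1 from its initial value that a x + b y
    must have drifted by 1/4. *)
Lemma superdense_gap : superdense L -> exists2 delta : R, 0 < delta &
  forall a b : int, (a != 0) || (b != 0) ->
  delta <= `|a%:~R * u + b%:~R * v| * (`|a| + `|b|)%N%:R.
Proof.
move=> [C C0 dense]; exists (32 * C)^-1 => [|a b ab].
  by rewrite invr_gt0 mulr_gt0.
set h := (`|a| + `|b|)%N.
have h0 : (0 < h)%N by rewrite /h addn_gt0 !absz_gt0.
have hR : 0 < (h%:R : R) by rewrite ltr0n.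
(* The value farthest from the initial one mod 1. *)
pose th := a%:~R * (L 0).1.2 + b%:~R * (L 0).2 + 2^-1.
have [c _] : exists c : squares S, True.
  by have /fset0Pn[c cS] := squares_neq0 S; exists [` cS]%fset.
have [x [y [xI yI xyI]]] : exists x y : R, [/\ 0 <= x <= 1, 0 <= y <= 1 &
    a%:~R * x + b%:~R * y - th \is a Num.int].
  have [a0|a0] := eqVneq a 0.
    rewrite a0 in ab; have [y yI yE] := solve_mod1 th ab.
    by exists 0, y; rewrite mulr0 add0r lexx ler01.
  have [x xI xE] := solve_mod1 th a0.
  by exists x, 0; rewrite mulr0 addr0 lexx ler01.
(* At this scale, points at a distance below 2 / (8 h) differ by less than 1/4 in
   the value of a x + b y mod 1. *)
have n1 : (1 <= 8 * h)%N by rewrite muln_gt0.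
have pS : on_surface ((c, x, y) : surface_point R S) by split.
have [t /andP[t0 tC] dist] := dense _ n1 _ pS.
have LS : on_surface (L t) by have [_ /(_ t t0)[]] := geo.
have [m] : exists2 m, joined (L t) (c, x, y) m & m < (4 * h%:R)^-1.
  apply: flat_dist_lt => //; apply: le_lt_trans dist _.
  by rewrite natrM ltf_pV2 ?posrE ?mulr_gt0 // ltr_pM2r // ltr_nat.
move=> /joined_lipschitz[m0 [i [j [iI jI]]]] /=.
set e1 := x - _ - i; set e2 := y - _ - j => he1 he2 mlt.
have [t1 t2] := geodesic_torus t0.
set w := a%:~R * u + b%:~R * v.
pose k := 2^-1 - t * w - (a%:~R * e1 + b%:~R * e2).
have kI : k \is a Num.int.
  have -> : k = a%:~R * ((L t).1.2 - (L 0).1.2 - t * u)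
     + b%:~R * ((L t).2 - (L 0).2 - t * v)
     + a%:~R * i + b%:~R * j - (a%:~R * x + b%:~R * y - th).
    by rewrite /k /th /e1 /e2 /w; ring.
  apply: rpredB => //; apply: rpredD; last exact/rpredM/jI/intr_int.
  apply: rpredD; last exact/rpredM/iI/intr_int.
  by apply: rpredD; apply: rpredM => //; apply: intr_int.
have he : `|a%:~R * e1 + b%:~R * e2| < 4^-1.
  apply: le_lt_trans (_ : h%:R * m < _).
    rewrite /h natrD mulrDl; apply: le_trans (ler_normD _ _) _.
    by rewrite !normrM -!intr_norm -!abszE lerD // ler_wpM2l.
  by rewrite mulrC -ltr_pdivlMr // -invfM.
have small : 4^-1 <= `|t * w|.
  rewrite leNgt; apply/negP => lt; apply: (int_between kI).
  by move: he lt; rewrite /k !ltr_norml; lra.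
move: small; rewrite normrM ger0_norm // => small.
have : 4^-1 <= C * (8 * h)%:R * `|w| by apply: le_trans small _; rewrite ler_wpM2r.
rewrite natrM => big.
rewrite -(ler_pM2l (mulr_gt0 (ltr0n R 32) C0)) mulfV ?gt_eqF ?mulr_gt0 //.
by move: big; lra.
Qed.

Lemma superdense_badly_approximable :
  superdense L -> u != 0 /\ badly_approximable (v / u).
Proof.
move=> /superdense_gap[delta d0 gap].
have u0 : u != 0.
  apply/eqP => u0; have := gap 1 0 isT.
  by rewrite u0 mulr0 mul0r addr0 normr0 mul0r leNgt d0.
split => //.
have uR : 0 < `|u| by rewrite normr_gt0.
pose B := `|u| * (`|v / u| + 2).
have B0 : 0 < B by rewrite mulr_gt0 // ltr_wpDl.
apply: (@badly_approximable_of_gap _ _ (Num.min 1 (delta / B))).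
  by rewrite lt_min ltr01 divr_gt0.
move=> p q q0; rewrite ge_min; set e := _ - _.
have qR : (1 : R) <= q%:~R by rewrite ler1z -gtz0_ge1.
have [big|small] := leP 1 `|e|.
  by apply/orP; left; apply: le_trans big _; rewrite ler_peMr.
apply/orP; right; rewrite ler_pdivrMr //.
have := gap (- p) q; rewrite (gt_eqF q0) orbT => /(_ isT) g.
have qabs : (`|q|%:R : R) = q%:~R by rewrite -[in RHS](gtz0_abs q0).
have pE : (`|- p|%:R : R) <= q%:~R * (`|v / u| + 1).
  rewrite abszN -[X in X <= _]/((`|p|%:Z)%:~R) abszE intr_norm.
  have -> : p%:~R = q%:~R * (v / u) - e by rewrite /e opprB addrC subrK.
  apply: le_trans (ler_normB _ _) _; rewrite mulrDr mulr1 normrM.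
  rewrite (ger0_norm (le_trans ler01 qR)) lerD2l.
  by apply: le_trans qR; apply: ltW.
apply: le_trans g _.
have -> : (- p)%:~R * u + q%:~R * v = u * e.
  by rewrite /e intrN mulrBr; field.
rewrite normrM natrD qabs /B.
have -> : `|e| * q%:~R * (`|u| * (`|v / u| + 2)) =
  `|u| * `|e| * (q%:~R * (`|v / u| + 1) + q%:~R) by ring.
by rewrite ler_wpM2l ?mulr_ge0 // lerD2r.
Qed.
End Geodesic.
End Surface.

(** * A geodesic follows the first-return map *)

Section Flow.
Variables (R : realType) (S : polysquare_surface).
Implicit Types (p q : surface_point R S) (c d : squares S) (x y X Y l t r : R).

(** Reversing an axis, so that both coordinates increase along the flow. *)
Definition orient (s : bool) (x : R) : R := if s then 1 - x else x.
Definition oriented (s : bool) (e : {perm squares S}) : {perm squares S} :=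
  if s then (e^-1)%g else e.

Lemma orientK s : involutive (orient s).
Proof. by case: s => x; rewrite /orient ?subKr. Qed.

Lemma orient_itv s x : (0 <= orient s x <= 1) = (0 <= x <= 1).
Proof. by case: s => //=; rewrite subr_ge0 gerBl andbC. Qed.

Lemma orient_dist s x y : `|orient s x - orient s y| = `|x - y|.
Proof.
case: s => //=; have -> : 1 - x - (1 - y) = y - x by ring.
exact: distrC.
Qed.

Section Orientation.
Variables su sv : bool.
Let E := oriented su (east S).
Let N := oriented sv (north S).

Definition place c X Y : surface_point R S := (c, orient su X, orient sv Y).

Lemma glue_E c Y : 0 <= Y <= 1 -> same_point (place c 1 Y) (place (E c) 0 Y).
Proof.
rewrite -(orient_itv sv) /place /E; case: su => YI /=; last exact/rst_step/GluedV.
rewrite subrr subr0 -[c in X in same_point X _](permKV (east S)).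
by apply/rst_sym/rst_step/GluedV.
Qed.

Lemma glue_N c X : 0 <= X <= 1 -> same_point (place c X 1) (place (N c) X 0).
Proof.
rewrite -(orient_itv su) /place /N; case: sv => XI /=; last exact/rst_step/GluedH.
rewrite subrr subr0 -[c in X in same_point X _](permKV (north S)).
by apply/rst_sym/rst_step/GluedH.
Qed.

(** The representative with both oriented coordinates in [0, 1[; the corners,
    which are glued together in a complicated way, are left without one. *)
Definition normal_form p : option (squares S * R * R) :=
  let X := orient su p.1.2 in let Y := orient sv p.2 in
  if ((X == 0) || (X == 1)) && ((Y == 0) || (Y == 1)) then None
  else if X == 1 then Some (E p.1.1, 0, Y)
  else if Y == 1 then Some (N p.1.1, X, 0) else Some (p.1.1, X, Y).

Lemma normal_form_same p q : same_point p q -> normal_form p = normal_form q.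
Proof.
have n01 : ((0 : R) == 1) = false by rewrite eq_sym oner_eq0.
have n10 : ((1 : R) == 0) = false by rewrite oner_eq0.
elim => {p q} [p q [c y _|c x _]|p|p q _ ->|p q r _ -> _ ->] //; rewrite /normal_form /=.
  set Y := orient sv y; rewrite /E /orient; case: su => /=;
    rewrite ?subrr ?subr0 !eqxx n01 ?n10 /=.
    case: ((Y == 0) || _) / orP => //; case: (Y == 1) / eqP => // ? h.
      by case: h; right.
    by rewrite permK.
  case: ((Y == 0) || _) / orP => //; case: (Y == 1) / eqP => // ? h.
  by case: h; right.
set X := orient su x; rewrite /N /orient; case: sv => /=;
  rewrite ?subrr ?subr0 !eqxx n01 ?n10 /= ?orbT !andbT.
  case: ((X == 0) || _) / orP => //; case: (X == 1) / eqP => // ? h.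
    by case: h; right.
  by rewrite permK.
case: ((X == 0) || _) / orP => //; case: (X == 1) / eqP => // ? h.
by case: h; right.
Qed.

Lemma normal_form_place c X Y : 0 <= X < 1 -> 0 <= Y < 1 ->
  normal_form (place c X Y) <> None -> normal_form (place c X Y) = Some (c, X, Y).
Proof.
move=> /andP[_ X1] /andP[_ Y1]; rewrite /normal_form /= !orientK.
by rewrite (lt_eqF X1) (lt_eqF Y1); case: ifP.
Qed.

Lemma place_inj p c X Y c' X' Y' : normal_form p <> None ->
  0 <= X < 1 -> 0 <= Y < 1 -> 0 <= X' < 1 -> 0 <= Y' < 1 ->
  same_point p (place c X Y) -> same_point p (place c' X' Y') ->
  [/\ c = c', X = X' & Y = Y'].
Proof.
move=> np XI YI XI' YI' /normal_form_same e /normal_form_same e'.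
have := normal_form_place (c := c) XI YI; rewrite -e => /(_ np).
have := normal_form_place (c := c') XI' YI'; rewrite -e' => /(_ np) ->.
by case.
Qed.

Lemma normal_form_None p : normal_form p = None ->
  p.1.2 \is a Num.int /\ p.2 \is a Num.int.
Proof.
have int01 s x : (orient s x == 0) || (orient s x == 1) -> x \is a Num.int.
  by case: s => /= /orP[] /eqP e; rewrite ?e // -[x](subKr 1) e ?subr0 ?subrr.
rewrite /normal_form; case: ifP => [/andP[h1 h2] _|_]; last by do 2?case: ifP.
by split; [apply: int01 h1|apply: int01 h2].
Qed.
End Orientation.

Section Follow.
Variables (L : R -> surface_point R S) (u v : R).
Hypothesis geo : half_infinite_geodesic L u v.
Hypotheses (u0 : u != 0) (v0 : v != 0) (irr : irrational (v / u)).
Let su := u < 0.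
Let sv := v < 0.
Let U : R := `|u|.
Let V : R := `|v|.
Let U0 : 0 < U. Proof. by rewrite normr_gt0. Qed.
Let V0 : 0 < V. Proof. by rewrite normr_gt0. Qed.

Lemma orient_flow w x r : orient (w < 0) x + r * w = orient (w < 0) (x + r * `|w|).
Proof.
rewrite /orient; case: ltP => [/ltW w0|w0].
  by rewrite ler0_norm //; ring.
by rewrite ger0_norm.
Qed.

(** Two visits of corners would be separated by an integral vector of slope
    v / u. *)
Lemma eventually_regular :
  exists2 t0, 0 <= t0 & forall t, t0 <= t -> normal_form su sv (L t) <> None.
Proof.
have [[t1 [t1_ge0 none]]|all] :=
    pselect (exists t1, 0 <= t1 /\ normal_form su sv (L t1) = None); last first.
  by exists 0 => // t t_ge0 e; apply: all; exists t.
exists (t1 + 1) => [|t lt e]; first by rewrite addr_ge0.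
have [x1 y1] := normal_form_None none; have [x2 y2] := normal_form_None e.
have t_ge0 : 0 <= t by lra.
have [a1 b1] := geodesic_torus geo t1_ge0; have [a2 b2] := geodesic_torus geo t_ge0.
have ui : (t - t1) * u \is a Num.int.
  have -> : (t - t1) * u = ((L t).1.2 - (L t1).1.2) -
    (((L t).1.2 - (L 0).1.2 - t * u) - ((L t1).1.2 - (L 0).1.2 - t1 * u)) by ring.
  by rewrite rpredB // rpredB.
have vi : (t - t1) * v \is a Num.int.
  have -> : (t - t1) * v = ((L t).2 - (L t1).2) -
    (((L t).2 - (L 0).2 - t * v) - ((L t1).2 - (L 0).2 - t1 * v)) by ring.
  by rewrite rpredB // rpredB.
have d0 : t - t1 != 0 by rewrite gt_eqF //; lra.
apply: irr; move: ui vi => /intrP[m mE] /intrP[n nE].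
exists (n%:~R / m%:~R) => //; rewrite rmorphM fmorphV /= !ratr_int -mE -nE.
by field; rewrite d0 u0.
Qed.

Lemma straight_place a b : a <= b -> straight_on L u v a b ->
  exists c X Y, forall t, a <= t <= b ->
  [/\ 0 <= X + (t - a) * U <= 1, 0 <= Y + (t - a) * V <= 1 &
      same_point (L t) (place su sv c (X + (t - a) * U) (Y + (t - a) * V))].
Proof.
move=> ab [c [x [y st]]]; exists c, (orient su x), (orient sv y) => t tI.
have [[]] := st t tI.
rewrite -[x](orientK su) -[y](orientK sv) !orient_flow !orientK.
by rewrite -/su -/sv !orient_itv.
Qed.

Section Late.
Variable t0 : R.
Hypotheses (t0_ge0 : 0 <= t0)
  (regular : forall t, t0 <= t -> normal_form su sv (L t) <> None).

(** Away from corners, representatives are unique: two straight pieces of the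
    geodesic which share a point run in the same square, so that the geodesic
    goes straight until it leaves the square. *)
Lemma flow t c X Y : t0 <= t -> 0 <= X -> 0 <= Y ->
  same_point (L t) (place su sv c X Y) ->
  forall r, 0 <= r -> X + r * U <= 1 -> Y + r * V <= 1 ->
  same_point (L (t + r)) (place su sv c (X + r * U) (Y + r * V)).
Proof.
have Upos := U0; have Vpos := V0; have t0ge0 := t0_ge0.
move=> tt0 X0 Y0 same r r0 rU rV.
have fwd (s : R) : 0 <= s -> exists2 d : R, 0 < d & straight_on L u v s (s + d).
  by case: geo => _ _ + _; apply.
have bwd (s : R) : 0 < s -> exists2 d : R, 0 < d <= s & straight_on L u v (s - d) s.
  by case: geo => _ _ _; apply.
pose P (s : R) := s <= r ->
  same_point (L (t + s)) (place su sv c (X + s * U) (Y + s * V)).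
have bound (s : R) : s < r -> X + s * U < 1 /\ Y + s * V < 1.
  move=> sr; split; [apply: lt_le_trans rU|apply: lt_le_trans rV].
    by rewrite ltrD2l ltr_pM2r.
  by rewrite ltrD2l ltr_pM2r.
have ge (s : R) : 0 <= s -> 0 <= X + s * U /\ 0 <= Y + s * V.
  by move=> s0; rewrite !addr_ge0 ?mulr_ge0 // ltW.
suff : forall s : R, 0 <= s -> P s by apply.
apply: real_induction.
- by rewrite /P addr0 !mul0r !addr0.
- move=> s s0 Ps sr; have ts0 : 0 < t + s by lra.
  have [d /andP[d0 dts] st] := bwd _ ts0.
  have [|c' [X' [Y' {}st]]] := straight_place _ st; first lra.
  (* At the time s1 < s both descriptions of the geodesic are available: in the
     square c by assumption, and in c' by straightness just before s. *)
  pose s1 := Num.max 0 (s - d).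
  have [s1_0 s1_s s1_d] : [/\ 0 <= s1, s1 < s & s - d <= s1].
    by rewrite /s1 /Num.max; case: ltP; split; lra.
  have [] := st (t + s1); first lra.
  have -> : t + s1 - (t + s - d) = s1 - s + d by ring.
  have [] := st (t + s); first lra.
  have -> : t + s - (t + s - d) = d by ring.
  move=> XI YI sameS XI1 YI1 same1.
  have lt1 : (s1 - s + d) * U < d * U by rewrite ltr_pM2r //; lra.
  have lt2 : (s1 - s + d) * V < d * V by rewrite ltr_pM2r //; lra.
  have [b1 b2] := bound s1 (lt_le_trans s1_s sr); have [g1 g2] := ge s1 s1_0.
  have [|||||||e1 e2 e3] := place_inj (regular _) _ _ _ _ (Ps s1 _ _) same1; try lra.
  have -> : X + s * U = X' + d * U by move: e2; rewrite !mulrDl mulNr; lra.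
  have -> : Y + s * V = Y' + d * V by move: e3; rewrite !mulrDl mulNr; lra.
  by rewrite e1.
move=> s s0 Ps; have [sr|rs] := ltP s r; last first.
  exists 1 => // s' /andP[ss' _] s'r.
  have -> : s' = s by lra.
  by apply: Ps; lra.
have ts0 : 0 <= t + s by lra.
have [d d0 st] := fwd _ ts0.
have [|c' [X' [Y' {}st]]] := straight_place _ st; first lra.
have [] := st (t + s + d); first lra.
have -> : t + s + d - (t + s) = d by ring.
have [] := st (t + s); first lra.
rewrite subrr !mul0r !addr0 => XI YI same1 XI1 YI1 _.
have lt1 : 0 < d * U by rewrite mulr_gt0.
have lt2 : 0 < d * V by rewrite mulr_gt0.
have [b1 b2] := bound s sr; have [g1 g2] := ge s s0.
have [||||||e1 e2 e3] := place_inj (regular _) _ _ _ _ (Ps _) same1; try lra.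
exists d => // s' s'I _.
have [|_ _] := st (t + s'); first lra.
rewrite -e1 -e2 -e3.
have -> : X + s * U + (t + s' - (t + s)) * U = X + s' * U by ring.
by have -> : Y + s * V + (t + s' - (t + s)) * V = Y + s' * V by ring.
Qed.

Definition square_level : level R (squares S) :=
  Level (fun b : bool => if b then V else U)
        (fun b : bool => if b then oriented su (east S) else oriented sv (north S))
        (fun=> 1%N).

Let T := induced square_level.

(** The point of the left or bottom side of a square where V X - U Y has the value
    s: it is on the bottom side if s >= 0 and on the left one otherwise. *)
Definition enters t (z : squares S * R) := base square_level z.2 /\
  same_point (L t) (place su sv z.1 (Num.max z.2 0 / V) (Num.max (- z.2) 0 / U)).

Lemma crossing t z X Y : t0 <= t -> enters t z ->
  0 <= X <= 1 -> 0 <= Y <= 1 -> V * X - U * Y = z.2 ->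
  exists2 t', t <= t' <= t + U^-1 & same_point (L t') (place su sv z.1 X Y).
Proof.
have Upos := U0; have Vpos := V0; have t0ge0 := t0_ge0.
move=> tt0 [_ same] XI YI s.
set X0 := Num.max z.2 0 / V in same; set Y0 := Num.max (- z.2) 0 / U in same.
have [X0_ge0 Y0_ge0 s0] : [/\ 0 <= X0, 0 <= Y0 & V * X0 - U * Y0 = z.2].
  rewrite /X0 /Y0; have [zpos|/ltW zneg] := leP 0 z.2.
    have zn : - z.2 <= 0 by rewrite oppr_le0.
    rewrite (max_r zn) mul0r mulr0 subr0 [V * _]mulrC.
    by rewrite divfK ?gt_eqF // divr_ge0 // ltW.
  have zn : 0 <= - z.2 by rewrite oppr_ge0.
  rewrite (max_l zn) mul0r mulr0 sub0r [U * _]mulrC.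
  by rewrite divfK ?gt_eqF // opprK divr_ge0 // ltW.
pose r : R := (X - X0) / U.
have rU : X0 + r * U = X by rewrite /r divfK ?gt_eqF // addrC subrK.
have rV : Y0 + r * V = Y.
  apply: (mulfI (lt0r_neq0 U0)).
  have -> : U * (Y0 + r * V) = U * Y0 + V * (X0 + r * U) - V * X0 by ring.
  by rewrite rU; lra.
have r0 : 0 <= r.
  have [zpos|zneg] := leP 0 z.2.
    have Y00 : Y0 = 0 by rewrite /Y0 max_r ?mul0r // oppr_le0.
    rewrite -(pmulr_lge0 _ V0); move: rV; rewrite Y00 add0r => ->; lra.
  have X00 : X0 = 0 by rewrite /X0 max_r ?mul0r // ltW.
  by rewrite /r X00 subr0 divr_ge0 ?(ltW U0) //; lra.
exists (t + r).
  rewrite lerDl r0 lerD2l -[U^-1]mul1r ler_pM2r ?invr_gt0 //; lra.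
by rewrite -rU -rV; apply: flow => //; rewrite ?rU ?rV; lra.
Qed.

Lemma entersE c t Y : 0 <= Y <= 1 -> same_point (L t) (place su sv c 1 Y) ->
  enters t (oriented su (east S) c, - (U * Y)).
Proof.
have Upos := U0; have Vpos := V0.
move=> YI same.
have UY : 0 <= U * Y by rewrite mulr_ge0 ?(ltW U0) //; lra.
have UY1 : U * Y <= U by rewrite ler_piMr ?(ltW U0) //; lra.
split; first by rewrite /base /=; lra.
rewrite /= opprK max_r ?oppr_le0 // max_l // mul0r mulrAC divff ?gt_eqF // mul1r.
by apply: rst_trans same _; apply: glue_E.
Qed.

Lemma entersN c t X : 0 <= X < 1 -> same_point (L t) (place su sv c X 1) ->
  enters t (oriented sv (north S) c, V * X).
Proof.
have Upos := U0; have Vpos := V0.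
move=> XI same.
have VX : 0 <= V * X by rewrite mulr_ge0 ?(ltW V0) //; lra.
have VX1 : V * X < V by rewrite gtr_pMr //; lra.
split; first by rewrite /base /=; lra.
rewrite /= max_l // [Num.max (- _) _]max_r ?oppr_le0 //.
rewrite mul0r mulrAC divff ?gt_eqF // mul1r.
by apply: rst_trans same _; apply: glue_N; lra.
Qed.

Lemma enters_next t z : t0 <= t -> enters t z ->
  exists2 t', t <= t' <= t + U^-1 & enters t' (T z).
Proof.
have Upos := U0; have Vpos := V0; have t0ge0 := t0_ge0.
case: z => c s tt0 ent; have [/= bs _] := ent; move: bs; rewrite /base /= => bs.
rewrite /T inducedE /letter /shift /=; case: leP => le.
  have YI : 0 <= (V - s) / U <= 1.
    by rewrite divr_ge0 ?(ltW U0) ?ler_pdivrMr //=; lra.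
  have [||t' tI same] := crossing (X := 1) (Y := (V - s) / U) tt0 ent _ YI.
  - by rewrite ler01 lexx.
  - by rewrite /= [U * _]mulrC divfK ?gt_eqF //; lra.
  exists t' => //; have := entersE YI same.
  by rewrite [U * _]mulrC divfK ?gt_eqF // opprB.
have XI : 0 <= (s + U) / V < 1.
  by rewrite divr_ge0 ?(ltW V0) ?ltr_pdivrMr //=; lra.
have [|||t' tI same] := crossing (X := (s + U) / V) (Y := 1) tt0 ent.
- lra.
- by rewrite ler01 lexx.
- by rewrite /= [V * _]mulrC divfK ?gt_eqF //; lra.
exists t' => //; have := entersN XI same.
by rewrite [V * _]mulrC divfK ?gt_eqF.
Qed.

Lemma enters_iter t z i : t0 <= t -> enters t z ->
  exists2 t', t <= t' <= t + i%:R * U^-1 & enters t' (iter i T z).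
Proof.
have Upos := U0; have Vpos := V0; have t0ge0 := t0_ge0.
move=> tt0 ent; elim: i => [|i [t' tI IH]].
  by exists t; rewrite ?mul0r ?addr0 ?lexx.
have [|t'' t''I ent''] := enters_next _ IH; first lra.
by exists t'' => //; rewrite -natr1 mulrDl mul1r; lra.
Qed.

Lemma enters_once : exists t z, t0 <= t /\ enters t z.
Proof.
have Upos := U0; have Vpos := V0; have t0ge0 := t0_ge0.
have [_ /(_ t0 t0_ge0)[+ _] _ _] := geo.
case E : (L t0) => [[c x] y]; rewrite /on_surface /= => -[].
rewrite -(orient_itv su x) -(orient_itv sv y) => XI YI.
have same : same_point (L t0) (place su sv c (orient su x) (orient sv y)).
  by rewrite E /place !orientK; apply: rst_refl.
move: (orient su x) (orient sv y) XI YI same => X Y XI YI same.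
pose r : R := Num.min ((1 - X) / U) ((1 - Y) / V).
have r0 : 0 <= r.
  by rewrite /r le_min !divr_ge0 ?(ltW U0) ?(ltW V0) //; lra.
have rU : X + r * U <= 1.
  by rewrite -lerBrDl -ler_pdivlMr // /r ge_min lexx.
have rV : Y + r * V <= 1.
  by rewrite -lerBrDl -ler_pdivlMr // /r ge_min lexx orbT.
have [rU0 rV0] : 0 <= r * U /\ 0 <= r * V by rewrite !mulr_ge0 ?(ltW U0) ?(ltW V0).
have := flow (lexx t0) _ _ same r0 rU rV; move=> /(_ _ _).
have X0 : 0 <= X by lra. have Y0 : 0 <= Y by lra.
move=> /(_ X0 Y0) same'; exists (t0 + r).
have [X1|X1] := eqVneq (X + r * U) 1.
  rewrite X1 in same'; eexists; split; first lra.
  by apply: entersE same'; lra.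
have Y1 : Y + r * V = 1.
  move: X1; rewrite /r; case: (leP ((1 - X) / U) ((1 - Y) / V)) => _.
    by rewrite (divfK (lt0r_neq0 U0)) addrCA subrr addr0 eqxx.
  by rewrite (divfK (lt0r_neq0 V0)) addrCA subrr addr0.
rewrite Y1 in same'; eexists; split; first lra.
by apply: entersN same'; move: rU; rewrite le_eqVlt (negPf X1) /=; lra.
Qed.
End Late.

(** Move right and then down to increase V X - U Y, up and then left to decrease
    it; the first motion stops at the boundary of the square. *)
Lemma chord_close X Y s : 0 <= X <= 1 -> 0 <= Y <= 1 -> - U <= s <= V ->
  exists X' Y', [/\ 0 <= X' <= 1, 0 <= Y' <= 1, V * X' - U * Y' = s,
    `|X' - X| <= `|s - (V * X - U * Y)| / V & `|Y' - Y| <= `|s - (V * X - U * Y)| / U].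
Proof.
have Upos := U0; have Vpos := V0.
move=> XI YI sI; set d := s - _.
have [dpos|dneg] := leP 0 d.
  pose a : R := Num.min (1 - X) (d / V).
  have [a0 a1 a2] : [/\ 0 <= a, a <= 1 - X & a <= d / V].
    by rewrite /a le_min !ge_min !lexx orbT divr_ge0 ?(ltW V0) //; split => //; lra.
  have da : 0 <= d - V * a by rewrite subr_ge0 mulrC -ler_pdivlMr.
  have Va : 0 <= V * a by rewrite mulr_ge0 // ltW.
  exists (X + a), (Y - (d - V * a) / U); split.
  - lra.
  - have h : 0 <= (d - V * a) / U by rewrite divr_ge0 // ltW.
    have h' : (d - V * a) / U <= Y.
      rewrite ler_pdivrMr //; rewrite /a; case: (leP (1 - X) (d / V)) => _.
        by rewrite /d mulrBr mulr1; lra.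
      by rewrite mulrC divfK ?gt_eqF // subrr mulr_ge0 ?(ltW U0) //; lra.
    lra.
  - rewrite !mulrDr mulrN [U * (_ / _)]mulrC divfK ?gt_eqF // /d; lra.
  - by rewrite addrC addKr !ger0_norm.
  rewrite addrC addKr normrN !ger0_norm ?divr_ge0 ?(ltW U0) //.
  by rewrite ler_pM2r ?invr_gt0 //; lra.
have {}dneg := ltW dneg; pose e := - d; have e0 : 0 <= e by rewrite oppr_ge0.
have -> : `|d| = e by rewrite ler0_norm.
pose a : R := Num.min (1 - Y) (e / U).
have [a0 a1 a2] : [/\ 0 <= a, a <= 1 - Y & a <= e / U].
  by rewrite /a le_min !ge_min !lexx orbT divr_ge0 ?(ltW U0) //; split => //; lra.
have da : 0 <= e - U * a by rewrite subr_ge0 mulrC -ler_pdivlMr.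
have Ua : 0 <= U * a by rewrite mulr_ge0 // ltW.
exists (X - (e - U * a) / V), (Y + a); split.
- have h : 0 <= (e - U * a) / V by rewrite divr_ge0 // ltW.
  have h' : (e - U * a) / V <= X.
    rewrite ler_pdivrMr //; rewrite /a; case: (leP (1 - Y) (e / U)) => _.
      by rewrite /e /d mulrBr mulr1; lra.
    by rewrite [U * _]mulrC divfK ?gt_eqF // subrr mulr_ge0 ?(ltW V0) //; lra.
  lra.
- lra.
- rewrite !mulrDr mulrN [V * (_ / _)]mulrC divfK ?gt_eqF // /e /d; lra.
- rewrite addrC addKr normrN !ger0_norm ?divr_ge0 ?(ltW V0) //.
  by rewrite ler_pM2r ?invr_gt0 //; lra.
by rewrite addrC addKr !ger0_norm.
Qed.

Lemma oriented_transitive :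
  transitive_pair (fun b : bool =>
    if b then oriented su (east S) else oriented sv (north S)).
Proof.
have or s (e : {perm squares S}) A (g : squares S -> A) :
    (forall c, g (oriented s e c) = g c) -> forall c, g (e c) = g c.
  by case: s => /= h c //; rewrite -[in RHS](permK e c) h.
move=> A g gp c d.
have ge := or _ _ _ _ (gp true); have gn := or _ _ _ _ (gp false).
have /connectP[s] := surface_connected c d.
elim: s c => [|b s IH] c /=; first by move=> _ ->.
by move=> /andP[/orP[/eqP <-|/eqP <-] bs] e; rewrite -(IH _ bs e).
Qed.

(** Target the chord of the square c through (X, Y), replaced by a nearby one at
    the corner where s = V, which is outside of the base. *)
Lemma superdense_of_euclid (K : nat) :
  (forall k (b : bool), 
    let w := iter k (@euclid_step R) (fun b : bool => if b then V else U) in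
    0 < w b <= K%:R * w (~~ b)) ->
  superdense L.
Proof.
have Upos := U0; have Vpos := V0.
move=> ratio.
have [t0 t0_ge0 regular] := eventually_regular.
have [t1 [z0 [t01 ent]]] := enters_once t0_ge0 regular.
have [C C0 dense] :=
  @orbit_dense R _ square_level K (fun=> erefl) oriented_transitive ratio.
have Ui0 : 0 < U^-1 by rewrite invr_gt0.
have Vi0 : 0 < V^-1 by rewrite invr_gt0.
(* Twice the error (V + U) / (m n), once for [orbit_dense] and once for the choice
   of the target, becomes a distance at most 1 / n by [chord_close]. *)
pose B := 2 * (V + U) * (V^-1 + U^-1).
pose m := (Num.bound B).+1.
have mR : 0 < (m%:R : R) by rewrite ltr0n.
have Bm : B <= m%:R.
  apply: ltW; apply: lt_trans (_ : (Num.bound B)%:R < _); last by rewrite ltr_nat.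
  by apply: archi_boundP; rewrite /B !mulr_ge0 ?addr_ge0 ?ltW.
have t1_ge0 : 0 <= t1 by lra.
exists (t1 + (C * m%:R + 1) * U^-1).
  by rewrite ltr_wpDl // mulr_gt0 // ltr_wpDl // mulr_ge0 ?ltW.
move=> n n1 [[c x] y] pS; have nR : 1 <= (n%:R : R) by rewrite ler1n.
pose X := orient su x; pose Y := orient sv y.
have [XI YI] : 0 <= X <= 1 /\ 0 <= Y <= 1 by rewrite !orient_itv.
pose s := V * X - U * Y.
have sI : - U <= s <= V.
  have : 0 <= V * X by rewrite mulr_ge0 ?(ltW V0) //; lra.
  have : V * X <= V by rewrite ler_piMr ?(ltW V0) //; lra.
  have : 0 <= U * Y by rewrite mulr_ge0 ?(ltW U0) //; lra.
  have : U * Y <= U by rewrite ler_piMr ?(ltW U0) //; lra.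
  by rewrite /s; lra.
pose eps := (V + U) / (m * n)%:R.
have mn0 : 0 < ((m * n)%:R : R) by rewrite ltr0n muln_gt0.
have eps0 : 0 < eps by rewrite divr_gt0 // addr_gt0.
have eps1 : eps <= V + U.
  by rewrite ler_pdivrMr // ler_peMr ?ler1n ?muln_gt0 // addr_ge0 // ltW.
have [s1 s1b s1s] : exists2 s1, base square_level s1 & `|s1 - s| <= eps.
  have [lt|ge] := ltP s V.
    exists s; first by rewrite /base /=; lra.
    by rewrite subrr normr0 ltW.
  by exists (V - eps); [rewrite /base /=; lra|rewrite ler_norml; lra].
have [z0b _] := ent.
have mn : (0 < m * n)%N by rewrite muln_gt0.
have [i [s2 [iC it s2s]]] := dense (m * n)%N mn z0.1 z0.2 c s1 z0b s1b.
rewrite -surjective_pairing in it.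
have [t2 t2I ent2] := enters_iter t0_ge0 regular i t01 ent.
rewrite it in ent2; have [/= s2b _] := ent2.
have s2I : - U <= s2 <= V by move: s2b; rewrite /base /=; lra.
have [X' [Y' [XI' YI' s2E dX dY]]] := chord_close XI YI s2I.
have [|t' t'I same] := crossing t0_ge0 regular _ ent2 XI' YI' s2E; first lra.
have d2 : `|s2 - s| <= 2 * eps.
  have -> : s2 - s = (s2 - s1) + (s1 - s) by ring.
  apply: le_trans (ler_normD _ _) _; rewrite mulr2n mulrDl mul1r lerD //.
exists t'.
  apply/andP; split; first lra.
  have h1 : i%:R * U^-1 <= C * (m * n)%:R * U^-1 by rewrite ler_wpM2r // ltW.
  have h2 : U^-1 <= n%:R * U^-1 by rewrite ler_peMl // ltW.
  have h3 : t1 <= t1 * n%:R by rewrite ler_peMr.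
  rewrite natrM in h1.
  have -> : (t1 + (C * m%:R + 1) * U^-1) * n%:R =
    t1 * n%:R + C * (m%:R * n%:R) * U^-1 + n%:R * U^-1 by ring.
  by lra.
have J : joined (L t') (c, x, y)
    (0 + Num.sqrt ((x - orient su X') ^+ 2 + (y - orient sv Y') ^+ 2)).
  apply: JoinedTrans (JoinedSame same) _; apply: JoinedSegment => //.
  by split; rewrite orient_itv.
apply: le_trans (flat_dist_le J) _; rewrite add0r.
have dist1 (a b : R) : Num.sqrt (a ^+ 2 + b ^+ 2) <= `|a| + `|b|.
  rewrite -[leRHS]ger0_norm ?addr_ge0 // -sqrtr_sqr ler_wsqrtr //.
  rewrite sqrrD !real_normK ?num_real //.
  by rewrite lerD2r lerDl mulrn_wge0 // mulr_ge0.
apply: le_trans (dist1 _ _) _.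
rewrite -[x](orientK su) -[y](orientK sv) !orient_dist !(distrC _ X') !(distrC _ Y').
apply: le_trans (lerD dX dY) _.
rewrite -mulrDr; apply: le_trans (_ : 2 * eps * (V^-1 + U^-1) <= _).
  by rewrite ler_wpM2r // addr_ge0 // ltW.
have -> : 2 * eps * (V^-1 + U^-1) = B / m%:R / n%:R.
  rewrite /eps /B natrM; field.
  by rewrite !gt_eqF // (lt_le_trans ltr01).
by rewrite -[leRHS]mul1r ler_wpM2r ?invr_ge0 // ler_pdivrMr // mul1r.
Qed.
End Follow.
End Flow.


Theorem theorem1 (R : realType) (S : polysquare_surface) (L : R -> surface_point R S)
    (u v : R) (hL : half_infinite_geodesic L u v) :
  superdense L <-> u != 0 /\ badly_approximable (v / u).
Proof.
split=> [|[u0 bad]]; first exact: superdense_badly_approximable.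
have [irr _] := bad.
have v0 : v != 0.
  by apply/eqP => v0; apply: irr; exists 0; rewrite // rmorph0 v0 mul0r.
have [|//|K] :=
  @badly_approximable_euclid R (v / u) (fun b : bool => if b then `|v| else `|u|) bad.
- by rewrite normr_gt0.
- by rewrite normrM normfV.
exact: superdense_of_euclid.
Qed.
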